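(* Let $m\ge 2$ and let $T$ be an $m$-uniform hypertree with $k$ edges and odd diameter $d=2p+1$, where $(k-d-1)(m-1)\ge 6$. Then $\lambda_1(T)\le \lambda_1(T_d(c_{p+1}=k-d))$, and equality holds only when $T=T_d(c_{p+1}=k-d)$.
   Context: A hypergraph has a finite vertex set and an edge set of non-empty subsets of the vertex set; it is $m$-uniform if all edges have cardinality $m$, and linear if two distinct edges share at most one vertex. The adjacency matrix of a linear $m$-uniform hypergraph $\mathcal{H}$ has $(i,j)$ entry $\frac{1}{m-1}$ if $i\ne j$ lie in a common edge, and $0$ otherwise; $\lambda_1(\mathcal{H})$ denotes its spectral radius. The degree of a vertex is the number of edges containing it; a vertex is pendant if its degree is one and non-pendant if its degree is larger. A loose path of length $d$, $P_L(d)=v_1e_1v_2e_2\dots v_de_dv_{d+1}$, is the $m$-uniform hypergraph with edges $e_1,\dots,e_d$ such that $e_{i-1}\cap e_i=\{v_i\}$ for $2\le i\le d$ (the $v_i$ distinct), non-consecutive edges are disjoint, and $v_1\in e_1$, $v_{d+1}\in e_d$ are pendant. A loose cycle of length $l\ge3$, $v_1e_1v_2e_2\dots v_le_lv_1$, is the $m$-uniform hypergraph with edges $e_1,\dots,e_l$ in which cyclically consecutive edges meet exactly in $v_i$ ($e_{i-1}\cap e_i=\{v_i\}$, indices mod $l$, the $v_i$ distinct) and non-consecutive edges are disjoint. A hypertree is a connected linear hypergraph containing no loose cycle in which every edge contains at most two non-pendant vertices. The diameter is the maximum distance between two vertices, distance being the minimum length (number of edges) of a path joining them. Attaching a pendant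 edge at a vertex $v$ means adding a new edge consisting of $v$ and $m-1$ new vertices. $T_d(c_2,\dots,c_d)$ is the hypertree obtained from $P_L(d)=v_1e_1v_2\dots v_de_dv_{d+1}$ by attaching $c_i$ pendant edges at $v_i$ for $i=2,\dots,d$; when only some of the $c_i$ are listed, the others are $0$. Equality of hypergraphs means isomorphism. *)

(* Defs.v *)
(* MathComp; the real numbers are an arbitrary R : realType.                  *)
(* finset and classical_sets share names: finset comes last so that set0,     *)
(* [set _ | _], ... denote finite sets; %classic marks the other kind.        *)
From mathcomp Require Import all_boot all_algebra.
From mathcomp Require Import classical_sets reals complex.
From mathcomp Require Import finset.

Set Implicit Arguments.
Unset Strict Implicit.
Unset Printing Implicit Defensive.

Import GRing.Theory Num.Theory.

(* The vertex set is the whole finite type V. *)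
Record hypergraph (V : finType) := Hypergraph {
  edges : {set {set V}};
  edges_neq0 : set0 \notin edges }.

Section Hypergraph.
Variables (V : finType) (H : hypergraph V).

Definition uniform (m : nat) : Prop := forall e, e \in edges H -> #|e| = m.

Definition linear_hypergraph : Prop :=
  forall e f, e \in edges H -> f \in edges H -> e != f -> #|e :&: f| <= 1.

Definition degree (x : V) : nat := #|[set e in edges H | x \in e]|.

Definition non_pendant (x : V) : bool := 1 < degree x.

(* x = v_0 e_0 v_1 e_1 ... e_(n-1) v_n = y with distinct vertices v_i and     *)
(* distinct edges e_i; in a linear hypergraph, the shortest such paths are    *)
(* exactly the shortest loose paths from x to y.                              *)
Definition joined_by_path (x y : V) (n : nat) : Prop :=
  exists (v : 'I_n.+1 -> V) (e : 'I_n -> {set V}),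
    [/\ injective v, injective e, v ord0 = x, v ord_max = y &
        forall i : 'I_n, [/\ e i \in edges H,
          v (widen_ord (leqnSn n) i) \in e i & v (lift ord0 i) \in e i]].

Definition connected_hypergraph : Prop :=
  forall x y : V, exists n, joined_by_path x y n.

Definition is_distance (x y : V) (n : nat) : Prop :=
  joined_by_path x y n /\ forall n', joined_by_path x y n' -> n <= n'.

Definition has_diameter (d : nat) : Prop :=
  (exists x y, is_distance x y d) /\
  (forall x y n, is_distance x y n -> n <= d).

(* ord_pred i is i - 1 modulo l. *)
Definition loose_cycle (l : nat) (v : 'I_l -> V) (e : 'I_l -> {set V}) : Prop :=
  [/\ 3 <= l, injective v, forall i, e i \in edges H,
      forall i, e (ord_pred i) :&: e i = [set v i] &
      forall i j, i != j -> i != ord_pred j -> j != ord_pred i ->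
        [disjoint e i & e j]].

Definition hypertree : Prop :=
  [/\ connected_hypergraph, linear_hypergraph,
      forall l (v : 'I_l -> V) (e : 'I_l -> {set V}), ~ loose_cycle v e &
      forall e, e \in edges H -> #|[set x in e | non_pendant x]| <= 2].

End Hypergraph.

Definition hypergraph_iso (V W : finType) (H : hypergraph V) (K : hypergraph W)
    : Prop :=
  exists2 f : V -> W, bijective f & [set f @: e | e : {set V} in edges H] = edges K.

(* Vertices are numbered by enum_val. *)
Definition adjacency_mx (R : realType) (V : finType) (m : nat)
    (H : hypergraph V) : 'M[R]_#|V| :=
  (\matrix_(i < #|V|, j < #|V|)
    if (i != j) &&
       [exists e in edges H, (enum_val i \in e) && (enum_val j \in e)]
    then (m.-1)%:R^-1 else 0)%R.

Definition spectral_radius (R : realType) (n : nat) (A : 'M[R]_n) : R :=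
  sup [set r : R | exists2 z : R[i],
    eigenvalue (map_mx (real_complex R) A) z & r = Normc.normc z]%classic.

Definition lambda1 (R : realType) (V : finType) (m : nat) (H : hypergraph V) : R :=
  spectral_radius (adjacency_mx R m H).

(* The loose path P_L(d): its vertices are 0, ..., d(m-1), its edges the d    *)
(* intervals [i(m-1), (i+1)(m-1)], 0 <= i < d.                                *)
Section LoosePath.
Variables (m d : nat).

Definition loose_path_edge (i : 'I_d) : {set 'I_(d * m.-1).+1} :=
  [set x : 'I_(d * m.-1).+1 | i * m.-1 <= x <= i.+1 * m.-1].

Lemma loose_path_edges_neq0 :
  set0 \notin [set loose_path_edge i | i : 'I_d].
Proof.
apply/imsetP => -[i _ /setP /(_ (inord (i * m.-1)))].
rewrite !inE inordK ?leqnn ?leq_mul2r ?leqnSn ?orbT //.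
by rewrite ltnS leq_mul2r (ltnW (ltn_ord i)) orbT.
Qed.

Definition loose_path : hypergraph 'I_(d * m.-1).+1 :=
  Hypergraph loose_path_edges_neq0.

(* The vertex v_i of v_1 e_1 v_2 ... v_d e_d v_(d+1), for 1 <= i <= d + 1. *)
Definition loose_path_vertex (i : nat) : 'I_(d * m.-1).+1 :=
  inord (i.-1 * m.-1).

End LoosePath.

(* Attaches, for each a : A, one pendant edge at the vertex b a: its m - 1    *)
(* new vertices are the inr (a, j), j < m - 1.                                *)
Section Attach.
Variables (m : nat) (V A : finType) (H : hypergraph V) (b : A -> V).

Definition attached_edge (a : A) : {set V + A * 'I_m.-1} :=
  inl (b a) |: [set inr (a, j) | j : 'I_m.-1].

Lemma attach_edges_neq0 :
  set0 \notin [set inl @: e | e : {set V} in edges H]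
              :|: [set attached_edge a | a : A].
Proof.
rewrite inE negb_or; apply/andP; split; apply/imsetP.
  case=> e eH /esym/eqP; rewrite imset_eq0 => /eqP e0.
  by move: (edges_neq0 H); rewrite -e0 eH.
by case=> a _ /setP /(_ (inl (b a))); rewrite !inE eqxx.
Qed.

Definition attach_pendant_edges : hypergraph (V + A * 'I_m.-1)%type :=
  Hypergraph attach_edges_neq0.

End Attach.

(* T_d(c_2, ..., c_d): the pendant edges are indexed by the pairs (i, s) with *)
(* s < c_(i+2), attached at v_(i+2), for 0 <= i < d - 1; only the values      *)
(* c 2, ..., c d matter.                                                      *)
Definition Td (m d : nat) (c : nat -> nat) :=
  attach_pendant_edges m (loose_path m d)
    (fun a : {i : 'I_d.-1 & 'I_(c i.+2)} => loose_path_vertex m d (tag a).+2).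

(* Main.v *)
Require Import Defs.
From mathcomp Require Import all_boot all_order all_algebra.
From mathcomp Require Import boolp classical_sets reals complex.
From mathcomp Require Import ring lra zify.
From mathcomp Require Import finset.

(* Write M = m - 1 and rho = M * lambda.  On a rooted hypertree, let b(v, e)   *)
(* be the ratio of the sum of an eigenvector over e minus v to its value at v. *)
(* Then b sums to rho over the edges at each vertex, and 1/(1 + b) sums to 1   *)
(* over each edge.  On T_d(c_(p+1) = n) this reads t_p + t_(p+1) + n t_1 = rho *)
(* where t_0 = 0 and                                                           *)
(*   1/(1 + t_(h+1)) + (M - 1)/(rho + 1) + 1/(rho + 1 - t_h) = 1.              *)
(* Conversely, if positive 1 + b satisfy these conditions with <= rho and <= 1,*)
(* Cauchy-Schwarz gives M * lambda <= rho, with equality only if the sums over *)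
(* the edges are all 1.  On an arbitrary hypertree with a path of length       *)
(* 2p + 1 rooted at its vertex v_(p+1), let the branch starting with the edge  *)
(* e have weight t_h + N t_1, where h is the length of its part of the path    *)
(* and N its number of other edges.  The edge condition then compares 1/a +    *)
(* 1/b with 1/(a + z) + 1/(b - z), and holds because t_(h-1) + t_h + z <= rho; *)
(* equality everywhere forces all the edges off the path to be attached at one *)
(* of the two central vertices.  The upper bound on the diameter is needed     *)
(* only to exclude p = 0.                                                      *)

(** Both spectral radii are compared with (s - 1) / M, where s solves the balance equation t_p +
    t_(p+1) + n t_1 = s - 1 with n = k - d. [exists_balanced_weight] finds such an s above M + 3 by
    the intermediate value theorem; the hypothesis (k - d - 1)(m - 1) >= 6 is what gives the sign at
    the left end M + 3. From that threshold on, the weights t_h increase with h and stay below (s -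
    1) / 2.

    For T_d(c_(p+1) = n), [Td_lambda1_ge] exhibits an eigenvector built from the t_h, hence (s - 1)
    / M <= lambda_1. For an arbitrary T, [hypertree_bound] roots T at a central vertex of a path of
    length d, puts weights on the incidences, and feeds them to [weighted_incidence_bound], a
    Cauchy-Schwarz argument edge by edge. In place of a Perron vector it uses the absolute values of
    a complex eigenvector for an eigenvalue of largest modulus. The edge condition holds because
    moving the same amount z onto the smaller of two denominators and off the larger one does not
    increase the sum of their inverses ([inv_sum_le]).

    If the two radii agree, every edge sum is 1, so each edge either has no edge off the path below
    it or is the middle edge with all of them below it. [extremal_counts] deduces that all these
    edges contain one and the same central vertex, and [spine_iso] then builds the isomorphism,
    after reversing the path if that vertex is the other centre. *)

Set Implicit Arguments.
Unset Strict Implicit.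
Unset Printing Implicit Defensive.

Import Order.TTheory GRing.Theory Num.Theory.

(** * Branch weights *)

Local Open Scope ring_scope.

(* The weight t_h of a bare path of h edges is s - N_h / D_h, where s, which   *)
(* stands for rho + 1, is the indeterminate of the polynomials N_h and D_h.    *)
Fixpoint branch_poly (R : realType) (M : R) (h : nat) : {poly R} * {poly R} :=
  if h is h'.+1 then
    let: (N, D) := branch_poly M h' in
    let D' := ('X - (M - 1)%:P) * N - 'X * D in
    (('X + 1) * D' - 'X * N, D')
  else ('X, 1).

Definition branch_weight (R : realType) (M s : R) (h : nat) : R :=
  s - (branch_poly M h).1.[s] / (branch_poly M h).2.[s].

Lemma branch_polyS (R : realType) (M s : R) (h : nat) :
  let N := (branch_poly M h).1.[s] in let D := (branch_poly M h).2.[s] in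
  (branch_poly M h.+1).2.[s] = (s - (M - 1)) * N - s * D /\
  (branch_poly M h.+1).1.[s] = (s + 1) * ((s - (M - 1)) * N - s * D) - s * N.
Proof. by rewrite /=; case: (branch_poly M h) => N D /=; rewrite !hornerE. Qed.

(** The second inequality says t_h <= (s - 1) / 2; it is the invariant that keeps the next
    denominator positive. *)
Lemma branch_poly_gt0 (R : realType) (M s : R) (h : nat) :
  1 <= M -> M + 3 <= s ->
  0 < (branch_poly M h).2.[s] /\
  (s + 1) * (branch_poly M h).2.[s] <= 2 * (branch_poly M h).1.[s].
Proof.
move=> M1 sM; elim: h => [|h [D0 ND]]; first by rewrite /= !hornerE; split; lra.
have [-> ->] := branch_polyS M s h.
move: D0 ND; set N := _.1.[s]; set D := _.2.[s] => D0 ND.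
have N0 : 0 < N.
  have : 0 < (s + 1) * D by apply: mulr_gt0 => //; lra.
  lra.
(* The threshold M + 3 enters as s - (M - 1) >= 4: the first product is at least 4 s N, and the
   invariant bounds s (s + 1) D by 2 s N. *)
have key : 2 * s * N <= (s + 1) * ((s - (M - 1)) * N - s * D).
  have : 4 * s <= (s - (M - 1)) * (s + 1) by nra.
  nra.
split; last by nra.
rewrite -(pmulr_rgt0 _ (_ : 0 < s + 1)); last lra.
by apply: lt_le_trans key; apply: mulr_gt0 => //; lra.
Qed.

Lemma branch_weight0 (R : realType) (M s : R) : branch_weight M s 0 = 0.
Proof. by rewrite /branch_weight /= !hornerE divr1 subrr. Qed.

Lemma branch_weight_le (R : realType) (M s : R) (h : nat) :
  1 <= M -> M + 3 <= s -> branch_weight M s h <= (s - 1) / 2.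
Proof.
move=> M1 sM.
have [D0 ND] := branch_poly_gt0 h M1 sM; rewrite /branch_weight.
have : (s + 1) / 2 <= (branch_poly M h).1.[s] / (branch_poly M h).2.[s].
  by rewrite ler_pdivlMr //; lra.
lra.
Qed.

(** This is the condition on an edge whose top has ratio t_(h+1): its M - 1 pendant vertices have
    ratio rho = s - 1, and the vertex carrying a branch of height h has the remaining ratio rho -
    t_h. *)
Lemma branch_weightS (R : realType) (M s : R) (h : nat) :
  1 <= M -> M + 3 <= s ->
  (1 + branch_weight M s h.+1)^-1 + (M - 1) / s + (s - branch_weight M s h)^-1 = 1
  /\ 0 < 1 + branch_weight M s h.+1.
Proof.
move=> M1 sM.
have [D0 ND] := branch_poly_gt0 h M1 sM.
have [D0' _] := branch_poly_gt0 h.+1 M1 sM.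
have [eD eN] := branch_polyS M s h; rewrite /branch_weight eN eD.
move: D0 ND D0'; rewrite eD; set N := _.1.[s]; set D := _.2.[s] => D0 ND D0'.
have N0 : 0 < N.
  have s1 : 0 < s + 1 by lra.
  have : 0 < (s + 1) * D by apply: mulr_gt0.
  by lra.
have eg : 1 + (s - ((s + 1) * ((s - (M - 1)) * N - s * D) - s * N) /
    ((s - (M - 1)) * N - s * D)) = s * N / ((s - (M - 1)) * N - s * D).
  by field; rewrite gt_eqF.
rewrite eg; have s0 : 0 < s by lra.
split; last by rewrite divr_gt0 // mulr_gt0.
rewrite (_ : s - (s - N / D) = N / D); last by ring.
rewrite !invf_div.
 by field; rewrite !gt_eqF.
Qed.

(** The recursion expresses t_(h+1) as an increasing function of t_h, so t_0 < t_1 propagates. *)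
Lemma branch_weight_lt (R : realType) (M s : R) (h : nat) :
  1 <= M -> M + 3 <= s -> branch_weight M s h < branch_weight M s h.+1.
Proof.
move=> M1 sM.
elim: h => [|h IHh].
  have [+ +] := branch_weightS 0 M1 sM; rewrite branch_weight0 subr0.
  set x := 1 + _ => ex x0.
  have : x^-1 < 1.
    have : 0 < s^-1 by rewrite invr_gt0; lra.
    have : 0 <= (M - 1) / s by rewrite divr_ge0 //; lra.
    lra.
  by rewrite invf_lt1 // /x; lra.
have [e1 p1] := branch_weightS h M1 sM; have [e2 p2] := branch_weightS h.+1 M1 sM.
have := branch_weight_le h M1 sM; have := branch_weight_le h.+1 M1 sM => l2 l1.
have : (s - branch_weight M s h)^-1 < (s - branch_weight M s h.+1)^-1.
  by rewrite ltf_pV2 ?posrE; lra.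
move=> lt; have : (1 + branch_weight M s h.+2)^-1 < (1 + branch_weight M s h.+1)^-1.
  by lra.
by rewrite ltf_pV2 ?posrE //; lra.
Qed.

Lemma branch_weight_ltn (R : realType) (M s : R) (i j : nat) :
  1 <= M -> M + 3 <= s -> (i < j)%N -> branch_weight M s i < branch_weight M s j.
Proof.
move=> M1 sM.
elim: j => // j IHj; rewrite ltnS leq_eqVlt => /predU1P[->|/IHj lt].
  exact: branch_weight_lt.
exact: lt_trans lt (branch_weight_lt j M1 sM).
Qed.

Lemma branch_weight_leq (R : realType) (M s : R) (i j : nat) :
  1 <= M -> M + 3 <= s -> (i <= j)%N -> branch_weight M s i <= branch_weight M s j.
Proof.
move=> M1 sM.
by rewrite leq_eqVlt => /predU1P[->|/(branch_weight_ltn M1 sM)/ltW].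
Qed.

Lemma branch_weight_ge0 (R : realType) (M s : R) (h : nat) :
  1 <= M -> M + 3 <= s -> 0 <= branch_weight M s h.
Proof. by move=> M1 sM; rewrite -(branch_weight0 M s) branch_weight_leq. Qed.

Lemma branch_weight1 (R : realType) (M s : R) :
  1 <= M -> M + 3 <= s -> branch_weight M s 1 = M / (s - M).
Proof.
move=> M1 sM.
have [+ +] := branch_weightS 0 M1 sM; rewrite branch_weight0 subr0.
set x := 1 + _ => ex x0.
have sM0 : 0 < s - M by lra.
have /(canRL invrK) ex' : x^-1 = (s - M) / s.
  by rewrite -[LHS](addrK ((M - 1) / s + s^-1)) addrA ex; field; lra.
have -> : branch_weight M s 1 = x - 1 by rewrite /x; ring.
by rewrite ex' invf_div; field; lra.
Qed.

(** If t_h <= 1, the other vertices contribute at most M / (s - 1) <= 1/2 to the edge sum, so 1 / (1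
    + t_(h+1)) >= 1/2. This serves at the right end of the interval in [exists_balanced_weight]. *)
Lemma branch_weight_le1 (R : realType) (M s : R) (h : nat) :
  1 <= M -> M + 3 <= s -> 2 * M + 1 <= s -> branch_weight M s h <= 1.
Proof.
move=> M1 sM s2; elim: h => [|h IHh]; first by rewrite branch_weight0.
have [e1 p1] := branch_weightS h M1 sM.
have : (s - branch_weight M s h)^-1 <= (s - 1)^-1 by rewrite lef_pV2 ?posrE; lra.
have : (M - 1) / s <= (M - 1) / (s - 1).
  by rewrite ler_wpM2l ?lef_pV2 ?posrE; lra.
have : (M - 1) / (s - 1) + (s - 1)^-1 <= 2^-1.
  rewrite -[X in _ + X]mul1r -mulrDl ler_pdivrMr; lra.
move=> a b c; have : 2^-1 <= (1 + branch_weight M s h.+1)^-1 by lra.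
by rewrite lef_pV2 ?posrE //; lra.
Qed.

Lemma exists_balanced_weight (R : realType) (M : R) (n p : nat) :
  1 <= M -> (0 < p)%N -> 6 <= (n%:R - 1) * M ->
  exists2 s, M + 3 <= s &
    branch_weight M s p + branch_weight M s p.+1
      + n%:R * branch_weight M s 1 = s - 1.
Proof.
move=> M1 p0 nM.
pose N h := (branch_poly M h).1; pose D h := (branch_poly M h).2.
(* [P] is [F] with its denominators cleared, a polynomial to which the intermediate value theorem of
   real closed fields applies; the cleared factor is positive on the interval. *)
pose P := (N p * D p.+1 + N p.+1 * D p - ('X + 1) * D p * D p.+1)
  * ('X - M%:P) - (n%:R * M)%:P * D p * D p.+1.
pose F s := s - 1 - (branch_weight M s p + branch_weight M s p.+1
  + n%:R * branch_weight M s 1).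
have D0 s h : M + 3 <= s -> 0 < (D h).[s].
  by move=> sM; have [] := branch_poly_gt0 h M1 sM.
have M0 s : M + 3 <= s -> 0 < s - M by lra.
have PF s : M + 3 <= s -> P.[s] = F s * ((D p).[s] * (D p.+1).[s] * (s - M)).
  move=> sM; have := D0 s p sM; have := D0 s p.+1 sM; have := M0 s sM.
  rewrite /F branch_weight1 // /branch_weight -!/(N _) -!/(D _).
  rewrite /P !(hornerD, hornerN, hornerM, hornerX, hornerC).
  move: (N p).[s] (N p.+1).[s] (D p).[s] (D p.+1).[s] => b1 b2 a1 a2 d1 d2 d3.
  by field; rewrite !gt_eqF.
have DD0 s : M + 3 <= s -> 0 < (D p).[s] * (D p.+1).[s] * (s - M).
  by move=> sM; rewrite !mulr_gt0 ?D0 ?M0.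
have n0 : 0 <= n%:R :> R by exact: ler0n.
have [b bE] : exists b, b = 2 * M + 3 + n%:R by exists (2 * M + 3 + n%:R).
have Mb : M + 3 <= b by rewrite bE; lra.
(* At s = M + 3, t_1 = M / 3, and t_p, t_(p+1) are at least t_1. So F <= M + 2 - (n + 2) M / 3,
   which is nonpositive exactly when (n - 1) M >= 6. *)
have Fa : F (M + 3) <= 0.
  have t1 : branch_weight M (M + 3) 1 = M / 3.
    by rewrite branch_weight1 //; congr (_ / _); ring.
  have tp : M / 3 <= branch_weight M (M + 3) p.
    by rewrite -t1 branch_weight_leq.
  have tp1 : M / 3 <= branch_weight M (M + 3) p.+1.
    by rewrite -t1 branch_weight_leq.
  by rewrite /F t1; lra.
(* Here all weights are at most 1, so F >= b - 1 - (2 + n) = 2 M. *)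
have Fb : 0 <= F b.
  have le1 h : branch_weight M b h <= 1.
    by apply: branch_weight_le1; rewrite // bE; lra.
  have := le1 p; have := le1 p.+1; have := ler_wpM2l n0 (le1 1%N).
  by rewrite /F mulr1; lra.
have [s sab /rootP Ps] : {s | s \in `[M + 3, b] & root P s}.
  apply: polyrcf.poly_ivt => //; rewrite !PF // mulr_le0_ge0 //.
    by rewrite mulr_le0_ge0 // ltW // DD0.
  by rewrite mulr_ge0 // ltW // DD0.
have sM : M + 3 <= s by move: sab; rewrite in_itv /= => /andP[].
exists s => //; move: Ps; rewrite PF // => /eqP.
by rewrite mulf_eq0 (gt_eqF (DD0 s sM)) orbF subr_eq0 => /eqP ->.
Qed.

(* For a fixed sum, 1/x + 1/y decreases as x and y get closer.                *)
Lemma inv_sum_le (R : realType) (a b z : R) :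
  0 < a -> 0 <= z -> a + z <= b ->
  (a + z)^-1 + (b - z)^-1 <= a^-1 + b^-1 /\
  ((a + z)^-1 + (b - z)^-1 = a^-1 + b^-1 -> z = 0 \/ a + z = b).
Proof.
move=> a0 z0 zb.
have bz : 0 < b - z by lra.
have az : 0 < a + z by lra.
have b0 : 0 < b by lra.
have e : a^-1 + b^-1 - ((a + z)^-1 + (b - z)^-1) =
  z * (b - a - z) * ((a + b) / (a * b * (a + z) * (b - z))).
  by field; rewrite !gt_eqF.
have c0 : 0 < (a + b) / (a * b * (a + z) * (b - z)).
  by rewrite divr_gt0 ?mulr_gt0 //; lra.
split; first by rewrite -subr_ge0 e mulr_ge0 ?(ltW c0) // mulr_ge0 //; lra.
move=> eq; move/eqP: e; rewrite eq subrr eq_sym mulf_eq0 (gt_eqF c0) orbF.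
by rewrite mulf_eq0 => /orP[/eqP ->|/eqP]; [left|right; lra].
Qed.

(** * Spectral radius and weighted incidences *)

Definition adjacent (V : finType) (H : hypergraph V) (v w : V) : bool :=
  (v != w) && [exists e in edges H, (v \in e) && (w \in e)].

Lemma adjacent_sym (V : finType) (H : hypergraph V) : symmetric (adjacent H).
Proof.
move=> v w; rewrite /adjacent eq_sym.
by under eq_existsb do rewrite [X in _ && X]andbC.
Qed.

Lemma adjacency_mxE (R : realType) (V : finType) (m : nat) (H : hypergraph V)
    (i j : 'I_#|V|) :
  adjacency_mx R m H i j =
  if adjacent H (enum_val i) (enum_val j) then (m.-1)%:R^-1 else 0.
Proof. by rewrite mxE /adjacent (inj_eq enum_val_inj). Qed.

(** The characteristic polynomial splits over [R[i]], so the supremum runs over a finite nonempty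
    set of moduli and is a maximum. *)
Lemma spectral_radius_attained (R : realType) (n : nat) (A : 'M[R]_n) :
  (0 < n)%N ->
  (exists2 z, eigenvalue (map_mx (real_complex R) A) z &
     Normc.normc z = spectral_radius A) /\
  (forall z, eigenvalue (map_mx (real_complex R) A) z ->
     Normc.normc z <= spectral_radius A).
Proof.
move=> n0; set B := map_mx _ A.
have [rs rsE] := closed_field_poly_normal (char_poly B).
have mem_rs z : eigenvalue B z = (z \in rs).
  rewrite eigenvalue_root_char rsE.
  by rewrite (monicP (char_poly_monic B)) scale1r root_prod_XsubC.
have rs0 : (0 < size rs)%N.
  have := size_char_poly B.
  rewrite rsE (monicP (char_poly_monic B)) scale1r size_prod_XsubC.
  by case=> ->.
pose i0 := [arg max_(i > Ordinal rs0) Normc.normc (rs`_i)]%O.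
have i0P z : eigenvalue B z -> Normc.normc z <= Normc.normc (rs`_i0).
  rewrite mem_rs /i0; case: arg_maxP => // i _ imax zrs.
  have zi : (index z rs < size rs)%N by rewrite index_mem.
  by have := imax (Ordinal zi) isT; rewrite /= nth_index.
have i0B : eigenvalue B (rs`_i0) by rewrite mem_rs mem_nth.
have -> : spectral_radius A = Normc.normc (rs`_i0).
  apply/eqP; rewrite eq_le; apply/andP; split.
    by apply: ge_sup => [|_ [z /i0P + ->]] //; exists (Normc.normc (rs`_i0)), rs`_i0.
  apply: ub_le_sup; last by exists rs`_i0.
  by exists (Normc.normc (rs`_i0)) => _ [z /i0P + ->].
by split=> //; exists rs`_i0.
Qed.

Lemma sum_enum_val (R : realType) (V : finType) (F : V -> R) :
  \sum_(i < #|V|) F (enum_val i) = \sum_v F v.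
Proof. by rewrite -big_enum_val. Qed.

Lemma lambda1_ge (R : realType) (V : finType) (m : nat) (H : hypergraph V)
    (y : V -> R) (rho : R) (v0 : V) :
  0 <= rho -> y v0 != 0 ->
  (forall v, \sum_(w | adjacent H v w) y w = rho * y v) ->
  rho / (m.-1)%:R <= lambda1 R m H.
Proof.
move=> rho0 y0 yA.
have V0 : (0 < #|V|)%N by apply/card_gt0P; exists v0.
have [_ le_rad] := spectral_radius_attained (adjacency_mx R m H) V0.
have q0 : 0 <= rho / (m.-1)%:R by rewrite divr_ge0 ?ler0n.
have nq : Normc.normc (rho / (m.-1)%:R)%:C%C = rho / (m.-1)%:R.
  by rewrite /= expr0n addr0 sqrtr_sqr ger0_norm.
rewrite -[leLHS]nq; apply: le_rad; apply/eigenvalueP.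
exists (\row_i (y (enum_val i))%:C%C); last first.
  apply/eqP => /rowP /(_ (enum_rank v0)); rewrite !mxE enum_rankK.
  by case=> y00; rewrite y00 eqxx in y0.
apply/rowP => j; rewrite !mxE.
transitivity ((\sum_i y (enum_val i) * adjacency_mx R m H i j)%:C%C).
  by rewrite rmorph_sum; apply: eq_bigr => i _; rewrite !mxE rmorphM.
rewrite -rmorphM; congr (_%:C%C).
rewrite mulrAC -yA [in RHS]big_mkcond mulr_suml -(sum_enum_val (V := V)).
apply: eq_bigr => i _; rewrite adjacency_mxE adjacent_sym.
by case: ifP => _; rewrite ?mulr0 ?mul0r.
Qed.

Lemma normc_ge0 (R : realType) (z : R[i]) : 0 <= Normc.normc z.
Proof. by case: z => a b; exact: sqrtr_ge0. Qed.

Lemma ler_normc_sum (R : realType) (I : finType) (F : I -> R[i]) :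
  Normc.normc (\sum_i F i) <= \sum_i Normc.normc (F i).
Proof.
elim/big_rec2: _ => [|i y x _ le]; first by rewrite Normc.normc0.
by apply: le_trans (le_normcD _ _) _; rewrite lerD2l.
Qed.

(** A substitute for the Perron vector: take the moduli of the entries of a complex eigenvector for
    an eigenvalue of largest modulus; the triangle inequality gives the inequality at each
    vertex. *)
Lemma lambda1_attained (R : realType) (V : finType) (m : nat)
    (H : hypergraph V) :
  (0 < #|V|)%N ->
  exists u : V -> R, [/\ forall v, 0 <= u v, exists v, 0 < u v &
    forall v, lambda1 R m H * u v <=
      (\sum_(w | adjacent H v w) u w) / (m.-1)%:R].
Proof.
move=> V0; have [[z zA zr] _] := spectral_radius_attained (adjacency_mx R m H) V0.
have [x xA x0] := eigenvalueP zA.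
exists (fun v => Normc.normc (x 0 (enum_rank v))); split.
- by move=> v; exact: normc_ge0.
- have /rV0Pn[i xi] := x0; exists (enum_val i); rewrite enum_valK.
  rewrite lt_def normc_ge0 andbT; apply: contraNneq xi => /Normc.eq0_normc ->.
  exact: eqxx.
move=> v; rewrite /lambda1 -zr -Normc.normcM.
have := congr1 (fun w : 'rV__ => w 0 (enum_rank v)) xA; rewrite !mxE => <-.
apply: le_trans (ler_normc_sum _) _.
rewrite [in leRHS]big_mkcond mulr_suml -(sum_enum_val (V := V)); apply: ler_sum => i _.
rewrite Normc.normcM mxE adjacency_mxE adjacent_sym !enum_rankK enum_valK.
have -> (a : R) : Normc.normc (a%:C)%C = `|a|.
  by rewrite /= expr0n addr0 sqrtr_sqr.
by case: ifP => _; rewrite ?normr0 ?mulr0 ?mul0r // ger0_norm // invr_ge0 ler0n.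
Qed.

(** Cauchy-Schwarz with its defect made explicit: the difference is the sum of c (u - S / c)^2 plus
    S^2 (1 - sum of 1 / c). Both terms are nonnegative, so equality kills both. *)
Lemma weighted_square_sum (R : realType) (V : finType) (e : {set V})
    (c u : V -> R) :
  (forall v, v \in e -> 0 < c v) -> \sum_(v in e) (c v)^-1 <= 1 ->
  let S := \sum_(v in e) u v in
  S ^+ 2 <= \sum_(v in e) c v * u v ^+ 2 /\
  (\sum_(v in e) c v * u v ^+ 2 <= S ^+ 2 ->
     (forall v, v \in e -> c v * u v = S) /\
     (S != 0 -> \sum_(v in e) (c v)^-1 = 1)).
Proof.
move=> c0 c1 S; pose Q := \sum_(v in e) c v * (u v - S / c v) ^+ 2.
have eQ : \sum_(v in e) c v * u v ^+ 2 - S ^+ 2 =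
    Q + S ^+ 2 * (1 - \sum_(v in e) (c v)^-1).
  have -> : Q = \sum_(v in e) (c v * u v ^+ 2 - 2 * S * u v + S ^+ 2 * (c v)^-1).
    by apply: eq_bigr => v /c0 cv; field; rewrite gt_eqF.
  by rewrite big_split sumrB /= -!mulr_sumr -/S; ring.
have Q0 : 0 <= Q.
  by apply: sumr_ge0 => v /c0 cv; rewrite mulr_ge0 ?sqr_ge0 // ltW.
have D0 : 0 <= S ^+ 2 * (1 - \sum_(v in e) (c v)^-1).
  by rewrite mulr_ge0 ?sqr_ge0 // subr_ge0.
split=> [|le]; first by rewrite -subr_ge0 eQ addr_ge0.
have Qz : Q = 0 by lra.
have Dz : S ^+ 2 * (1 - \sum_(v in e) (c v)^-1) = 0 by lra.
split=> [v ve|S0]; last first.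
  by move/eqP: Dz; rewrite mulf_eq0 sqrf_eq0 (negPf S0) subr_eq0 => /eqP.
have /psumr_eq0P : \sum_(v in e) c v * (u v - S / c v) ^+ 2 = 0 by [].
have h w : w \in e -> 0 <= c w * (u w - S / c w) ^+ 2.
  by move=> /c0 cw; rewrite mulr_ge0 ?sqr_ge0 // ltW.
move=> /(_ h v ve) /eqP; have cv := c0 v ve.
rewrite mulf_eq0 gt_eqF //= sqrf_eq0 subr_eq0 => /eqP ->.
by rewrite mulrC divfK // gt_eqF.
Qed.

Section WeightedIncidence.
Variables (R : realType) (V : finType) (H : hypergraph V).
Variables (c : V -> {set V} -> R) (rho : R).
Hypothesis c_gt0 : forall e v, e \in edges H -> v \in e -> 0 < c v e.
Hypothesis c_edge : forall e, e \in edges H -> \sum_(v in e) (c v e)^-1 <= 1.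
Hypothesis c_vertex :
  forall v, \sum_(e in edges H | v \in e) (c v e - 1) <= rho.

Lemma adjacent_sum_le (u : V -> R) (v : V) :
  (forall w, 0 <= u w) ->
  \sum_(w | adjacent H v w) u w <=
    \sum_(e in edges H | v \in e) (\sum_(w in e) u w - u v).
Proof.
move=> u0.
have -> : \sum_(e in edges H | v \in e) (\sum_(w in e) u w - u v) =
    \sum_(e in edges H | v \in e) \sum_w (if (w != v) && (w \in e) then u w else 0).
  apply: eq_bigr => e /andP[_ ve].
  rewrite (bigD1 v) //= addrAC subrr add0r -big_mkcond /=.
  by apply: eq_bigl => w; rewrite andbC.
rewrite exchange_big big_mkcond /=; apply: ler_sum => w _.
case: ifP => [/andP[vw /existsP[e /and3P[eH ve we]]]|_].
  rewrite (bigD1 e) ?eH //= eq_sym vw we lerDl.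
  by apply: sumr_ge0 => f _; case: ifP.
by apply: sumr_ge0 => f _; case: ifP.
Qed.

(** With [X] the sum of the squared edge sums, [Y] the sum of u^2 over incidences and [Z] its
    c-weighted version, the quadratic form is at most X - Y, the edge condition gives X <= Z, and
    the vertex condition gives Z - Y <= rho times the square norm. Equality forces X = Z, hence
    equality on each edge. *)
Lemma weighted_incidence_quadratic (u : V -> R) :
  (forall v, 0 <= u v) ->
  \sum_v u v * (\sum_(w | adjacent H v w) u w) <= rho * \sum_v u v ^+ 2 /\
  (rho * \sum_v u v ^+ 2 <= \sum_v u v * (\sum_(w | adjacent H v w) u w) ->
   forall e, e \in edges H ->
   (forall v, v \in e -> c v e * u v = \sum_(w in e) u w) /\
   (\sum_(w in e) u w != 0 -> \sum_(v in e) (c v e)^-1 = 1)).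
Proof.
move=> u0.
pose S (e : {set V}) := \sum_(w in e) u w.
pose X := \sum_(e in edges H) (S e) ^+ 2.
pose Y := \sum_(e in edges H) \sum_(v in e) u v ^+ 2.
pose Z := \sum_(e in edges H) \sum_(v in e) c v e * u v ^+ 2.
have exch (F : {set V} -> V -> R) :
    \sum_v \sum_(e in edges H | v \in e) F e v =
    \sum_(e in edges H) \sum_(v in e) F e v.
  rewrite (exchange_big_dep (mem (edges H))) //=; last by move=> ? ? _ /andP[].
  by apply: eq_bigr => e eH; apply: eq_bigl => v; rewrite eH.
have leXY : \sum_v u v * (\sum_(w | adjacent H v w) u w) <= X - Y.
  rewrite /X /Y -sumrB.
  have -> : \sum_(e in edges H) (S e ^+ 2 - \sum_(v in e) u v ^+ 2) =
      \sum_(e in edges H) \sum_(v in e) u v * (S e - u v).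
    apply: eq_bigr => e eH; rewrite expr2 {1}/S mulr_suml -sumrB.
    by apply: eq_bigr => v _; rewrite mulrBr expr2.
  rewrite -exch; apply: ler_sum => v _; rewrite -mulr_sumr.
  by rewrite ler_wpM2l // adjacent_sum_le.
have leZ : Z - Y <= rho * \sum_v u v ^+ 2.
  rewrite /Z /Y -sumrB.
  under eq_bigr do rewrite -sumrB.
  rewrite -exch mulr_sumr; apply: ler_sum => v _.
  under eq_bigr do rewrite -[X in _ - X]mul1r -mulrBl.
  by rewrite -mulr_suml ler_wpM2r ?sqr_ge0.
have edge e (eH : e \in edges H) :=
  weighted_square_sum u (fun v => c_gt0 eH (v := v)) (c_edge eH).
have leXZ : X <= Z by apply: ler_sum => e eH; case: (edge e eH).
split=> [|le]; first by lra.
have eqXZ : Z - X = 0 by lra.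
have h0 f : f \in edges H -> 0 <= \sum_(v in f) c v f * u v ^+ 2 - S f ^+ 2.
  by move=> fH; rewrite subr_ge0; case: (edge f fH).
move: eqXZ; rewrite /X /Z -sumrB => /(psumr_eq0P h0) h e eH.
by apply: (edge e eH).2; rewrite -subr_le0 h.
Qed.

(* With c v e = 1 + b v e, the Cauchy-Schwarz inequality on each edge bounds   *)
(* (sum of u over e)^2 by the sum over v in e of c v e * (u v)^2; the equality *)
(* case forces u > 0 everywhere by connectedness.                              *)
Lemma weighted_incidence_bound (m : nat) :
  (1 < m)%N -> (0 < #|V|)%N ->
  lambda1 R m H <= rho / (m.-1)%:R /\
  (connected_hypergraph H -> lambda1 R m H = rho / (m.-1)%:R ->
   forall e, e \in edges H -> \sum_(v in e) (c v e)^-1 = 1).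
Proof.
move=> m1 V0; have [u [u0 [v1 uv1] lam_u]] := lambda1_attained R m H V0.
have M0 : 0 < m.-1%:R :> R by rewrite ltr0n; lia.
have [quad tight] := weighted_incidence_quadratic u0.
have norm0 : 0 < \sum_v u v ^+ 2.
  rewrite (bigD1 v1) //= ltr_pwDl ?exprn_gt0 //.
  by apply: sumr_ge0 => v _; rewrite sqr_ge0.
have lamQ : lambda1 R m H * m.-1%:R * \sum_v u v ^+ 2 <=
    \sum_v u v * (\sum_(w | adjacent H v w) u w).
  rewrite mulr_sumr; apply: ler_sum => v _.
  rewrite expr2 mulrCA ler_wpM2l // mulrAC -ler_pdivlMr //.
split=> [|conn eq e eH].
  by rewrite ler_pdivlMr // -(ler_pM2r norm0) (le_trans lamQ).

have {tight} tight : forall e, e \in edges H ->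
   (forall v, v \in e -> c v e * u v = \sum_(w in e) u w) /\
   (\sum_(w in e) u w != 0 -> \sum_(v in e) (c v e)^-1 = 1).
  apply: tight; apply: le_trans lamQ.
  by rewrite eq divfK // gt_eqF.
have spread f v w : f \in edges H -> v \in f -> w \in f -> 0 < u v -> 0 < u w.
  move=> fH vf wf uv; rewrite -(pmulr_rgt0 _ (c_gt0 fH wf)).
  by rewrite (tight f fH).1 // -((tight f fH).1 v) // mulr_gt0 // c_gt0.
have [v ve] : exists v, v \in e.
  by apply/set0Pn; apply: contraTneq eH => ->; exact: edges_neq0.
have uv : 0 < u v.
  have [n [x [g [_ _ x0 xn xg]]]] := conn v1 v.
  have pos (i : nat) (le : (i < n.+1)%N) : 0 < u (x (Ordinal le)).
    elim: i le => [|i IHi] le.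
      by rewrite (_ : Ordinal le = ord0) ?x0 //; apply: val_inj.
    have [gH g1 g2] := xg (Ordinal (le : (i < n)%N)).
    apply: (spread _ (x (Ordinal (ltnW le))) _ gH _ _ (IHi (ltnW le))).
      rewrite (_ : Ordinal _ = widen_ord (leqnSn n) (Ordinal (le : (i < n)%N))) //.
      exact: val_inj.
    rewrite (_ : Ordinal _ = lift ord0 (Ordinal (le : (i < n)%N))) //.
    exact: val_inj.
  by rewrite -xn -[ord_max]/(Ordinal (ltnSn n)).
apply: (tight e eH).2; rewrite gt_eqF // -((tight e eH).1 v) //.
by rewrite mulr_gt0 // c_gt0.
Qed.

End WeightedIncidence.

Local Close Scope ring_scope.

(** * Rooted hypertrees *)

Definition edge_rel (V : finType) (H : hypergraph V) (F : pred {set V}) : rel V :=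
  fun x y => [exists f in edges H, [&& F f, x \in f & y \in f]].

(** Unlike [joined_by_path], repetitions are allowed, so walks concatenate; [F] restricts the edges
    used, typically to those other than a given edge. *)
Definition walk (V : finType) (H : hypergraph V) (F : pred {set V})
    (x y : V) (n : nat) : Prop :=
  exists p, [/\ path (edge_rel H F) x p, last x p = y & size p = n].

Ltac nat_lia :=
  repeat match goal with
  | H : forall _, _ |- _ => clear H
  | H : is_true (in_mem _ _) |- _ => clear H
  | H : is_true (path _ _ _) |- _ => clear H
  | H : is_true (negb (eq_op _ _)) |- _ => clear H
  end; lia.

(** * Walks and the absence of loose cycles *)

Section Walks.
Variables (V : finType) (H : hypergraph V).
Implicit Types (F : pred {set V}) (x y z : V).

Lemma edge_relP F x y :
  reflect (exists f, [/\ f \in edges H, F f, x \in f & y \in f])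
          (edge_rel H F x y).
Proof.
apply: (iffP existsP) => [[f /and4P[]]|[f [? ? ? ?]]]; first by exists f.
by exists f; apply/and4P.
Qed.

Lemma edge_rel_sym F : symmetric (edge_rel H F).
Proof.
by move=> x y; apply/edge_relP/edge_relP => -[f [? ? ? ?]]; exists f.
Qed.

Lemma walk0 F x : walk H F x x 0.
Proof. by exists [::]. Qed.

Lemma walk1 F x y f :
  f \in edges H -> F f -> x \in f -> y \in f -> walk H F x y 1.
Proof.
by move=> *; exists [:: y]; split=> //=; rewrite andbT; apply/edge_relP; exists f.
Qed.

Lemma walk_cat F x y z n k :
  walk H F x y n -> walk H F y z k -> walk H F x z (n + k).
Proof.
move=> [p [pp lp <-]] [q [pq lq <-]]; exists (p ++ q).
by rewrite cat_path last_cat size_cat pp lp.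
Qed.

Lemma connect_walk F x y : connect (edge_rel H F) x y -> exists n, walk H F x y n.
Proof. by case/connectP => p pp ->; exists (size p), p. Qed.

Lemma walkS F x y n :
  walk H F x y n.+1 ->
  exists z f, [/\ walk H F x z n, f \in edges H, F f, z \in f & y \in f].
Proof.
move=> [p [pp lp sp]]; case: (lastP p) pp lp sp => // q z.
rewrite rcons_path last_rcons size_rcons => /andP[pq /edge_relP[f [fH Ff f1 f2]]] <- [sq].
by exists (last x q), f; split=> //; exists q.
Qed.

Lemma joined_by_path_connect F x y n :
  (forall f, f \in edges H -> F f) ->
  joined_by_path H x y n -> connect (edge_rel H F) x y.
Proof.
move=> HF [v [e [_ _ <- <- ve]]].
suff pos (i : nat) (le : i < n.+1) :
    connect (edge_rel H F) (v ord0) (v (Ordinal le)).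
  by rewrite -[ord_max]/(Ordinal (ltnSn n)).
elim: i le => [|i IHi] le.
  by rewrite (_ : Ordinal le = ord0) //; apply: val_inj.
have [eH e1 e2] := ve (Ordinal (le : i < n)).
apply: connect_trans (IHi (ltnW le)) (connect1 _).
apply/edge_relP; exists (e (Ordinal (le : i < n))); split=> //; first exact: HF.
  rewrite (_ : Ordinal _ = widen_ord (leqnSn n) (Ordinal (le : i < n))) //.
  exact: val_inj.
rewrite (_ : Ordinal _ = lift ord0 (Ordinal (le : i < n))) //; exact: val_inj.
Qed.

Hypothesis lin : linear_hypergraph H.
Hypothesis acyclic :
  forall l (v : 'I_l -> V) (e : 'I_l -> {set V}), ~ loose_cycle H v e.

Lemma linear_eq e f x y :
  e \in edges H -> f \in edges H -> x != y ->
  x \in e -> y \in e -> x \in f -> y \in f -> e = f.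
Proof.
move=> eH fH xy xe ye xf yf; apply/eqP/negPn/negP => ef.
have := lin eH fH ef; apply/negP; rewrite -ltnNge.
by apply/card_gt1P; exists x, y; rewrite !inE xe ye xf yf.
Qed.

Lemma linear_setI e f x :
  e \in edges H -> f \in edges H -> e != f -> x \in e -> x \in f ->
  e :&: f = [set x].
Proof.
move=> eH fH ef xe xf; apply/setP => y; rewrite !inE.
apply/andP/eqP => [[ye yf]|-> //]; apply/eqP/negPn/negP => yx.
by move/negP: ef; apply; rewrite (@linear_eq e f y x).
Qed.

(* Two vertices of e that are closest to each other outside e would close up  *)
(* to a loose cycle through e.                                                *)
Lemma walk_around_edge e a b n :
  e \in edges H -> a \in e -> b \in e -> a != b ->
  ~ walk H (predC1 e) a b n.
Proof.
move=> eH; elim/ltn_ind: n a b => n IH a b ae be ab [p [pp lp sp]].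
pose u i := nth a (a :: p) i.
have u0 : u 0 = a by [].
have un : u n = b by rewrite /u -sp -lp; exact: (nth_last a (a :: p)).
have /fin_all_exists[g gP] (i : 'I_n) : exists f,
    [/\ f \in edges H, f != e, u i \in f & u i.+1 \in f].
  have ip : i < size p by rewrite sp.
  by have /edge_relP[f [? ? ? ?]] := pathP a pp i ip; exists f.
pose f i := if insub i is Some j then g j else e.
have fP i : i < n -> [/\ f i \in edges H, f i != e, u i \in f i & u i.+1 \in f i].
  by move=> lt; rewrite /f insubT; exact: gP.
have step i k : i + k <= n -> walk H (predC1 e) (u i) (u (i + k)) k.
  elim: k => [|k IHk] le; first by rewrite addn0; exact: walk0.
  have [|fH fe f1 f2] := fP (i + k); first by nat_lia.
  rewrite -addn1 addnA; apply: walk_cat (IHk _) _; first by nat_lia.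
  by rewrite addn1; exact: walk1 fH fe f1 f2.
have stepj i j : i <= j <= n -> walk H (predC1 e) (u i) (u j) (j - i).
  by case/andP=> ij jn; have := @step i (j - i); rewrite subnKC //; apply.
(* By strong induction the walk is as short as possible, among all pairs of distinct vertices of
   [e]. Every coincidence among its vertices and edges that would spoil the loose cycle yields a
   shortcut. *)
have short k : k < n -> ~ walk H (predC1 e) a b k by move=> lt; exact: IH.
have u_neq i j : i < j <= n -> u i != u j.
  case/andP => ij jn; apply/eqP => uij.
  have w1 := stepj 0 i; have w2 := stepj j n.
  apply: (short (i - 0 + (n - j))); first by nat_lia.
  apply: (walk_cat (y := u i)); first by rewrite -u0; apply: w1; nat_lia.
  by rewrite uij -un; apply: w2; nat_lia.
have far i j w : i.+2 <= j < n -> w \in f i -> w \in f j -> False.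
  case/andP => ij jn wi wj.
  have [|iH ie i1 i2] := fP i; first by nat_lia.
  have [|jH je j1 j2] := fP j; first by nat_lia.
  apply: (short (i - 0 + 1 + 1 + (n - j.+1))); first by nat_lia.
  rewrite -u0 -un; apply: walk_cat (stepj _ _ _); last by nat_lia.
  apply: walk_cat (walk1 jH je wj j2); apply: walk_cat (walk1 iH ie i1 wi).
  by apply: stepj; nat_lia.
(* If an interior edge met [e] at w, the walk could start at w = a, or, for w != a, stop at w; in
   both cases a shorter walk joins two distinct vertices of [e]. *)
have off i w : 0 < i -> i.+1 < n -> w \in f i -> w \notin e.
  move=> i0 iN wi; apply/negP => we.
  have [|iH ie i1 i2] := fP i; first by nat_lia.
  have [wa|wa] := eqVneq w a.
    apply: (short (1 + (n - i.+1))); first by nat_lia.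
    rewrite -wa -un; apply: walk_cat (walk1 iH ie wi i2) _.
    by apply: stepj; nat_lia.
  apply: (IH (i - 0 + 1) _ a w) => //; [by nat_lia | by rewrite eq_sym |].
  by rewrite -u0; apply: walk_cat (walk1 iH ie i1 wi); apply: stepj; nat_lia.
have consec i : i.+1 < n -> f i :&: f i.+1 = [set u i.+1].
  move=> lt; have [|iH ie i1 i2] := fP i; first by nat_lia.
  have [|jH je j1 j2] := fP i.+1; first by nat_lia.
  apply: linear_setI => //; apply/eqP => ij.
  apply: (short (i - 0 + 1 + (n - i.+2))); first by nat_lia.
  rewrite -u0 -un; apply: walk_cat (stepj _ _ _); last by nat_lia.
  apply: walk_cat (walk1 iH ie i1 _); last by rewrite ij.
  by apply: stepj; nat_lia.
have [n1|n2] := leqP n 1.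
  have n1' : n = 1.
    move: n1 un; case: (n) => [|[|//]] // _ ; rewrite u0 => e0.
    by rewrite e0 eqxx in ab.
  have [|fH fe f1 f2] := fP 0; first by rewrite n1'.
  move/negP: fe; apply; apply/eqP; apply: (linear_eq fH eH ab) => //.
  by rewrite -un n1'.
have predE (j : 'I_n.+1) : (ord_pred j : nat) = if (j : nat) is i.+1 then i else n.
  case: j => -[|j] lt /=; first by rewrite ?add0n modn_small.
  by rewrite modnDr modn_small; nat_lia.
(* The cycle is e, f_0, ..., f_(n-1). Edge j shares with its predecessor the vertex u_(j-1), and the
   index 0 wraps around to u_n = b. *)
pose E (j : 'I_n.+1) := if (j : nat) is i.+1 then f i else e.
pose w (j : 'I_n.+1) := u (ord_pred j).
apply: (acyclic (l := n.+1) (v := w) (e := E)); split=> //.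
- move=> i j; have uinj k l : k <= n -> l <= n -> u k = u l -> k = l.
    move=> kn ln ukl; case: (ltngtP k l) => // lt.
      by have := u_neq k l; rewrite lt ln ukl eqxx => /(_ isT).
    by have := u_neq l k; rewrite lt kn ukl eqxx => /(_ isT).
  have le (k : 'I_n.+1) : ord_pred k <= n by rewrite -ltnS ltn_ord.
  move=> /(uinj _ _ (le i) (le j)) /val_inj.
  exact: (can_inj (@ord_predK _)).
- move=> [[|i] lt]; rewrite /E //=.
  by have [] := fP i.
- move=> j; rewrite /w /E !predE; case: j => -[|[|i]] lt /=.
  + case: (n) (n2) un fP => // k k1 uk /(_ k (ltnSn k)) [fH fe f1 f2].
    by apply: linear_setI => //; move: be; rewrite -uk.
  + have [|fH fe f1 f2] := fP 0; first by nat_lia.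
    by apply: linear_setI => //; rewrite eq_sym.
  + by apply: consec; nat_lia.
- have dis (i j : 'I_n.+1) : i < j -> i != ord_pred j -> j != ord_pred i ->
      [disjoint E i & E j].
    have ordE (x y : 'I_n.+1) : (x == y) = (x == y :> nat) by [].
    rewrite /E !ordE !predE => ij.
    rewrite disjoint_subset; case: i j ij => -[|i] li [[|j] lj] //= ij ij1 ji1.
      apply/fintype.subsetP => x xe; rewrite inE; apply: contraL xe; apply: off; lia.
    apply/fintype.subsetP => x xi; rewrite inE; apply/negP; apply: far xi; lia.
  move=> i j; case: (ltngtP i j) => [lt _|lt _|/val_inj ->]; last by rewrite eqxx.
    exact: dis.
  by move=> h1 h2; rewrite disjoint_sym; apply: dis.
Qed.
End Walks.

(* top e is the vertex of e closest to c, so that every vertex other than c   *)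
(* has exactly one edge of which it is not the top.                           *)
Definition rooted (V : finType) (H : hypergraph V) (c : V)
    (top : {set V} -> V) (depth : V -> nat) : Prop :=
  [/\ forall e, e \in edges H -> top e \in e /\
        (forall v, v \in e -> connect (edge_rel H (predC1 e)) c v -> v = top e),
      forall e v, e \in edges H -> v \in e -> v != top e ->
        depth v = (depth (top e)).+1,
      forall v, v != c -> exists e, [/\ e \in edges H, v \in e & v != top e],
      forall v e f, e \in edges H -> f \in edges H -> v \in e -> v \in f ->
        v != top e -> v != top f -> e = f &
      forall e, e \in edges H -> c \in e -> top e = c].

(** Depth is the distance to c, and the top of an edge is a vertex of least depth. By
    [walk_around_edge], two vertices of an edge that are connected without that edge are equal, and
    this yields every uniqueness claim. *)
Lemma rooted_hypertree (V : finType) (H : hypergraph V) (c : V) :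
  connected_hypergraph H -> linear_hypergraph H ->
  (forall l (v : 'I_l -> V) (e : 'I_l -> {set V}), ~ loose_cycle H v e) ->
  exists top depth, rooted H c top depth.
Proof.
move=> conn lin acyclic.
have bridge e a b : e \in edges H -> a \in e -> b \in e ->
    connect (edge_rel H (predC1 e)) a b -> a = b.
  move=> eH ae be /connect_walk[n w]; apply/eqP/negPn/negP => ab.
  exact: (walk_around_edge lin acyclic eH ae be ab w).
have exD v : exists n, `[< walk H predT c v n >].
  have [n cv] := conn c v.
  have [//|k w] := connect_walk (joined_by_path_connect (F := predT) _ cv).
  by exists k; apply/asboolP.
pose D v := ex_minn (exD v).
have DP v : walk H predT c v (D v) by rewrite /D; case: ex_minnP => n /asboolP.
have Dmin v n : walk H predT c v n -> D v <= n.
  by move=> w; rewrite /D; case: ex_minnP => k _; apply; apply/asboolP.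
have Dedge e x y : e \in edges H -> x \in e -> y \in e -> D y <= (D x).+1.
  move=> eH xe ye; apply: Dmin; rewrite -addn1.
  exact: walk_cat (DP x) (walk1 eH _ xe ye).
have connect_sym_edge e : connect_sym (edge_rel H (predC1 e)).
  exact/sym_connect_sym/edge_rel_sym.
pose top (e : {set V}) := odflt c [pick x in e | [forall y in e, D x <= D y]].
have topP e : e \in edges H -> top e \in e /\ forall y, y \in e -> D (top e) <= D y.
  move=> eH; have /set0Pn[x0 x0e] : e != set0.
    by apply: contraTneq eH => ->; exact: edges_neq0.
  rewrite /top; case: pickP => [x /andP[xe /forall_inP]//|none].
  case: (arg_minnP D x0e) => x xe xmin; have /negbT := none x.
  rewrite /= (xe : x \in e) /= => /negP[]; exact/forall_inP.
(* A shortest walk to v only uses edges whose top is closer to c than v. Hence it avoids every edge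
   whose top is at least as far as v, which is [low_avoid]. *)
have low v : connect (edge_rel H (fun f => D (top f) < D v)) c v.
  have [n] := ubnP (D v); elim: n v => // n IH v; rewrite ltnS => Dv.
  case E: (D v) => [|k].
    have [p [_ lp /eqP]] := DP v; rewrite E size_eq0 => /eqP p0.
    by move: lp; rewrite p0 /= => ->; exact: connect0.
  have := DP v; rewrite E => /walkS[x [f [w fH _ xf vf]]].
  have Dx : D x <= k by exact: Dmin.
  have Df : D (top f) <= k by apply: leq_trans Dx; exact: (topP f fH).2.
  apply: (connect_trans (y := x)); last first.
    by apply: connect1; apply/edge_relP; exists f.
  apply: (connect_sub _ (IH x _)); last by lia.
  move=> y z /edge_relP[g [gH Dg yg zg]]; apply: connect1.
  by apply/edge_relP; exists g; split=> //; lia.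
have low_avoid e v : D v <= D (top e) -> connect (edge_rel H (predC1 e)) c v.
  move=> le; apply: connect_sub (low v) => y z /edge_relP[g [gH Dg yg zg]].
  apply: connect1; apply/edge_relP; exists g; split=> //=.
  by apply: contraTneq Dg => ->; rewrite -leqNgt.
have Dtop e v : e \in edges H -> v \in e -> v != top e -> D v = (D (top e)).+1.
  move=> eH ve vt; have [te tmin] := topP e eH.
  apply/eqP; rewrite eqn_leq (Dedge _ _ _ eH te ve) /= ltnNge; apply: contra vt => le.
  apply/eqP/(bridge e) => //; apply: connect_trans (low_avoid e (top e) _) => //.
  by rewrite (connect_sym_edge e); apply: low_avoid.
exists top, D; split=> //.
- move=> e eH; have [te _] := topP e eH; split=> // v ve cv.
  apply: (bridge e) => //; rewrite connect_sym_edge in cv.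
  exact: connect_trans cv (low_avoid e (top e) (leqnn _)).
- move=> v vc; case E: (D v) => [|k].
    have [p [_ lp /eqP]] := DP v; rewrite E size_eq0 => /eqP p0.
    by rewrite p0 /= in lp; rewrite lp eqxx in vc.
  have := DP v; rewrite E => /walkS[x [f [w fH _ xf vf]]].
  exists f; split=> //; apply: contraTneq (Dmin _ _ w) => vt.
  by have := (topP f fH).2 x xf; rewrite -vt E; lia.
- move=> v e f eH fH ve vf vte vtf; apply/eqP/negPn/negP => ef.
  case/negP: (vte); apply/eqP/(bridge e) => //; first exact: (topP e eH).1.
  apply: connect_trans (low_avoid e (top e) _) => //.
  rewrite (connect_sym_edge e); apply: (connect_trans (y := top f)).
    apply: low_avoid; have := Dtop f v fH vf vtf.
    by rewrite (Dtop e v eH ve vte) => -[->].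
  apply: connect1; apply/edge_relP; exists f; split=> //=; first by rewrite eq_sym.
  exact: (topP f fH).1.
- move=> e eH ce; apply/eqP/negPn/negP => tc.
  have := Dtop e c eH ce; rewrite eq_sym => /(_ tc).
  by have := Dmin _ _ (walk0 H predT c); lia.
Qed.

(* The edge g i joins x i to x i.+1: the vertex v_(i+1) of the paper is x i.   *)
Definition spine (V : finType) (H : hypergraph V) (d : nat)
    (x : nat -> V) (g : nat -> {set V}) : Prop :=
  [/\ forall i, i < d -> [/\ g i \in edges H, x i \in g i & x i.+1 \in g i],
      forall i j, i < d -> j < d -> g i = g j -> i = j &
      forall i j, i <= d -> j <= d -> x i = x j -> i = j].

Lemma joined_by_path_spine (V : finType) (H : hypergraph V) (a b : V) (d : nat) :
  joined_by_path H a b d ->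
  exists x g, spine H d x g.
Proof.
move=> [v [e [vI eI _ _ ve]]].
exists (fun i => v (inord i)).
exists (fun i => if insub i is Some j then e j else set0); split.
- move=> i lt; rewrite insubT; have [eH e1 e2] := ve (Ordinal lt); split=> //.
    rewrite (_ : inord i = widen_ord (leqnSn d) (Ordinal lt)) //.
    by apply/val_inj; rewrite /= inordK // ltnW // ltnS.
  rewrite (_ : inord i.+1 = lift ord0 (Ordinal lt)) //.
  by apply/val_inj; rewrite /= inordK.
- by move=> i j li lj; rewrite !insubT => /eI[].
- move=> i j li lj /vI /(congr1 val); rewrite /= !inordK //.
Qed.

(** For d = 2p + 1 the reversal exchanges the central vertices [x p] and [x p.+1], which settles the
    second case of [extremal_counts]. *)
Lemma spine_rev (V : finType) (H : hypergraph V) (d : nat) x g :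
  spine H d x g -> spine H d (fun i => x (d - i)) (fun i => g (d - i.+1)).
Proof.
move=> [xg gI xI]; split=> [i lt|i j li lj /gI eq|i j li lj /xI eq].
- have [|gH g1 g2] := xg (d - i.+1); first by lia.
  by split=> //; rewrite (_ : d - i = (d - i.+1).+1) //; lia.
- suff : d - i.+1 = d - j.+1 by lia.
  by apply: eq; lia.
- suff : d - i = d - j by lia.
  by apply: eq; lia.
Qed.

(* N e is the total w-weight of the edges f whose way to c passes through e,   *)
(* e included.                                                                 *)
Lemma subtree_counts (V : finType) (H : hypergraph V) (c : V) top depth
    (w : {set V} -> nat) :
  rooted H c top depth ->
  exists N : {set V} -> nat,
  [/\ forall e, e \in edges H -> N e = w e +
        \sum_(f in edges H | (top f \in e) && (top f != top e)) N f,
      \sum_(e in edges H | top e == c) N e = \sum_(e in edges H) w e &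
      forall e, e \in edges H -> N e <= \sum_(f in edges H) w f].
Proof.
move=> [topP depthS parent parent_uniq rootP].
pose child (f e : {set V}) := (top f \in e) && (top f != top e).
pose b := \max_(v : V) depth v.
(* Recursion on fuel: the top of a child is one level deeper than that of its parent, and depths are
   at most b, so fuel b + 1 reaches the stable value. *)
pose F := fix F (i : nat) (e : {set V}) : nat := w e +
  if i is i'.+1 then \sum_(f in edges H | child f e) F i' f else 0.
have stable i e : e \in edges H -> b - depth (top e) < i -> F i.+1 e = F i e.
  elim: i e => [|i IH] e eH; first by rewrite ltn0.
  move=> le; rewrite [LHS]/= [RHS]/=; congr (_ + _).
  apply: eq_bigr => f /and3P[fH fe ft]; apply: IH => //.
  have := depthS e _ eH fe ft => ->.
  have : depth (top f) <= b by rewrite /b (bigD1 (top f)) //= leq_maxl.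
  by rewrite (depthS e _ eH fe ft); lia.
exists (F b.+1); pose N := F b.+1; rewrite -/N.
have NE e : e \in edges H -> N e = w e + \sum_(f in edges H | child f e) N f.
  by move=> eH; rewrite /N -stable //; lia.
have parentE f : f \in edges H -> top f != c ->
    exists2 e, e \in edges H & forall e', e' \in edges H -> child f e' = (e' == e).
  move=> fH fc; have [e [eH fe ft]] := parent _ fc; exists e => // e' e'H.
  apply/andP/eqP => [[fe' ft']|-> //].
  exact: parent_uniq ft' ft.
(* Summed over all edges, the recursion counts each edge not topped at c once, as the child of its
   unique parent; these terms cancel. *)
have total : \sum_(e in edges H | top e == c) N e = \sum_(e in edges H) w e.
  apply/eqP; rewrite -(eqn_add2r (\sum_(e in edges H | top e != c) N e)).
  apply/eqP; rewrite -(bigID (fun e => top e == c)) /=.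
  rewrite (eq_bigr _ NE) big_split /=; congr (_ + _).
  rewrite (exchange_big_dep (fun f => (f \in edges H) && (top f != c))) /=; last first.
    move=> e f eH /and3P[-> fe ft] /=; apply: contraNneq ft => fc.
    by rewrite fc eq_sym rootP // -fc.
  apply: eq_bigr => f /andP[fH fc]; have [e eH eP] := parentE f fH fc.
  rewrite (big_pred1 e) // => e'; rewrite fH /=.
  case e'H: (e' \in _) => /=; first exact: eP.
  by apply/esym/eqP => e'e; rewrite e'e eH in e'H.
split=> // e; have [n] := ubnP (depth (top e)).
elim: n e => // n IH e; rewrite ltnS => le eH.
have [ec|ec] := eqVneq (top e) c.
  by rewrite -total (bigD1 e) ?eH ?ec ?eqxx //= leq_addr.
have [e1 e1H e1P] := parentE e eH ec.
have /andP[ee1 et] : child e e1 by rewrite e1P.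
apply: leq_trans (IH e1 _ e1H); last by rewrite (depthS e1 _ e1H ee1 et) in le.
rewrite (NE e1 e1H) (bigD1 e) /= ?eH ?e1P ?eqxx //.
by rewrite addnCA leq_addr.
Qed.

(* The length of the part of the spine beyond g j, seen from its middle; 0 for *)
(* an edge off the spine.                                                      *)
Definition spine_height (V : finType) (d : nat) (g : nat -> {set V})
    (e : {set V}) : nat :=
  \max_(j < d | g j == e) minn j.+1 (d - j).

(** * A path of length 2p + 1 in a hypertree rooted at its vertex [x p] *)

Section RootedSpine.
Variables (V : finType) (H : hypergraph V) (p : nat).
Variables (x : nat -> V) (g : nat -> {set V}).
Variables (top : {set V} -> V) (depth : V -> nat).
Hypothesis p_gt0 : 0 < p.
Hypothesis xg : spine H (2 * p + 1) x g.
Hypothesis rootedH : rooted H (x p) top depth.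
Local Notation d := (2 * p + 1).
Local Notation height := (spine_height d g).

Lemma spine_edge i : i < d -> [/\ g i \in edges H, x i \in g i & x i.+1 \in g i].
Proof. by case: xg => h _ _; exact: h. Qed.

Lemma spine_edge_inj i j : i < d -> j < d -> g i = g j -> i = j.
Proof. by case: xg => _ h _; exact: h. Qed.

Lemma spine_neq i j : i <= d -> j <= d -> i != j -> x i != x j.
Proof.
case: xg => _ _ h id jd ij; apply: contra_neq ij; exact: h.
Qed.

Lemma spine_connect j i n : i + n <= d -> j < d -> (j < i) || (i + n <= j) ->
  connect (edge_rel H (predC1 (g j))) (x i) (x (i + n)).
Proof.
elim: n => [|n IHn] le jd ij; first by rewrite addn0 connect0.
have ind : i + n < d by nat_lia.
have [gH g1 g2] := spine_edge ind.
apply: (connect_trans (y := x (i + n))); first by apply: IHn; nat_lia.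
rewrite addnS; apply/connect1/edge_relP; exists (g (i + n)); split=> //=.
by apply/eqP => /(spine_edge_inj ind jd); nat_lia.
Qed.

(** The end of [g j] nearer to [x p] is reached from the root along the spine without using
    [g j]. *)
Lemma spine_top j : j < d -> top (g j) = if j < p then x j.+1 else x j.
Proof.
have [topP _ _ _ _] := rootedH; move=> jd.
have [gH g1 g2] := spine_edge jd; have [_ h] := topP _ gH.
case: ltnP => jp; apply/esym/h => //.
  rewrite (sym_connect_sym (edge_rel_sym H _)).
  have := @spine_connect j j.+1 (p - j.+1); rewrite subnKC //.
  by apply; nat_lia.
by have := @spine_connect j p (j - p); rewrite subnKC //; apply; nat_lia.
Qed.

Lemma height_spine j : j < d -> height (g j) = minn j.+1 (d - j).
Proof.
move=> jd; rewrite /spine_height (big_pred1 (Ordinal jd)) //= => i.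
apply/eqP/eqP => [/(spine_edge_inj (ltn_ord i) jd) ij|-> //].
exact: val_inj.
Qed.

Lemma height_gt0 e : 0 < height e -> exists2 j, j < d & e = g j.
Proof.
rewrite /spine_height lt0n => h; apply/exists2P/not_existsP => none.
case/negP: h; rewrite big1 // => j /eqP ge.
by case: (none j); split.
Qed.

Lemma height_le e : height e <= p.+1.
Proof.
have [|/height_gt0[j jd ->]] := posnP (height e); first by nat_lia.
rewrite height_spine //; nat_lia.
Qed.

Lemma spine_child j e : j < d -> e \in edges H ->
  top (g j) \in e -> top (g j) != top e ->
  exists2 i, i < d & [/\ e = g i, height (g j) = (height e).-1 &
    j = if i < p then i.-1 else i.+1].
Proof.
have [_ _ _ uniq rootP] := rootedH; move=> jd eH.
have [gH g1 g2] := spine_edge jd; rewrite (spine_top jd).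
case: ltnP => jp xe xt.
  have jp1 : j.+1 < p.
    rewrite ltn_neqAle jp andbT; apply: contraNneq xt => jp'.
    by rewrite rootP // -jp' // jp'.
  have j1d : j.+1 < d by nat_lia.
  have [iH i1 i2] := spine_edge j1d.
  have -> : e = g j.+1.
    apply: (uniq (x j.+1)) => //; rewrite (spine_top j1d) jp1.
    by apply: spine_neq; nat_lia.
  by exists j.+1; rewrite ?jp1 //; split=> //; rewrite !height_spine //; nat_lia.
have pj : p < j.
  rewrite ltn_neqAle jp andbT; apply: contraNneq xt => jp'.
  by rewrite rootP // jp'.
have j1d : j.-1 < d by nat_lia.
have [iH i1 i2] := spine_edge j1d; rewrite prednK in i2; last by nat_lia.
have -> : e = g j.-1.
  apply: (uniq (x j)) => //; rewrite (spine_top j1d) ltnNge -ltnS prednK ?pj; last by nat_lia.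
  by apply: spine_neq; nat_lia.
exists j.-1 => //; rewrite ltnNge -ltnS prednK ?pj /=; last by nat_lia.
by split=> //; rewrite ?height_spine //; nat_lia.
Qed.

(** At most one child of an edge lies on the spine, and then its height is one less; the children
    off the spine contribute t 0 = 0. *)
Lemma child_height_sum (R : realType) (t : nat -> R) (e : {set V}) :
  t 0 = 0%R -> (forall h, 0 <= t h)%R -> e \in edges H ->
  (\sum_(f in edges H | (top f \in e) && (top f != top e)) t (height f)
     <= t (height e).-1)%R.
Proof.
move=> t0 tge eH.
pose P (f : {set V}) := [&& f \in edges H, top f \in e, top f != top e & 0 < height f].
have [f0 /and4P[fH fe ft fh]|none] := pickP P; last first.
  rewrite big1 // => f /and3P[fH fe ft]; have := none f.
  by rewrite /P fH fe ft /= lt0n => /negbFE/eqP ->.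
have [j jd fj] := height_gt0 fh; rewrite fj in fe ft.
have [i id_ [ei hj ji]] := spine_child jd eH fe ft.
rewrite (bigD1 f0) ?fH ?fj ?fe ?ft //= hj big1 ?addr0 // => f.
rewrite -andbA => /and3P[fH' /andP[fe' ft'] ff0].
have [->//|/height_gt0[j' j'd fj']] := posnP (height f).
rewrite fj' in fe' ft' ff0.
have [i' i'd [ei' _ ji']] := spine_child j'd eH fe' ft'.
have ii : i' = i by apply: spine_edge_inj; rewrite // -ei -ei'.
by rewrite ji' ii -ji eqxx in ff0.
Qed.

Lemma root_height_sum (R : realType) (t : nat -> R) :
  t 0 = 0%R ->
  (\sum_(f in edges H | top f == x p) t (height f) = t p + t p.+1)%R.
Proof.
move=> t0; have pd : p < d by nat_lia. have p1d : p.-1 < d by nat_lia.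
have [pH p1 p2] := spine_edge pd; have [qH q1 q2] := spine_edge p1d.
have pq : g p.-1 != g p by apply/eqP => /(spine_edge_inj p1d pd); nat_lia.
rewrite (bigD1 (g p.-1)) /=; last first.
  by rewrite qH spine_top // ltn_predL p_gt0 prednK // eqxx.
rewrite (bigD1 (g p)) /=; last first.
  by rewrite pH spine_top // ltnn eqxx eq_sym pq.
rewrite !height_spine // big1 ?addr0 => [|f].
  by congr (t _ + t _)%R; nat_lia.
rewrite -!andbA => /and4P[fH /eqP ft fq fp].
have [->//|/height_gt0[j jd fj]] := posnP (height f).
move: ft; rewrite fj spine_top //; case: ltnP => jp /eqP xj.
  case/negP: fq; rewrite fj; apply/eqP; congr g; apply/eqP.
  apply: contraTT xj => jp1; apply: spine_neq;
    move: jp jp1 jd p_gt0; clear; lia.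
case/negP: fp; rewrite fj; apply/eqP; congr g; apply/eqP.
by apply: contraTT xj => jp1; apply: spine_neq;
    move: jp jp1 jd p_gt0; clear; lia.
Qed.

Lemma off_spineP e :
  reflect (forall j, j < d -> g j != e) (height e == 0).
Proof.
apply: (iffP idP) => [/eqP h j jd|none].
  by apply/eqP => gj; move: h; rewrite -gj height_spine //; nat_lia.
have [//|/height_gt0[j jd ej]] := posnP (height e).
by have := none j jd; rewrite ej eqxx.
Qed.

Lemma card_off_spine n : #|edges H| = d + n ->
  \sum_(e in edges H) (height e == 0 : nat) = n.
Proof.
have gI : injective (fun i : 'I_d => g i).
  by move=> i j /(spine_edge_inj (ltn_ord i) (ltn_ord j)) /val_inj.
move=> cE; pose G := [set g i | i : 'I_d].
have cG : #|G| = d by rewrite card_imset // card_ord.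
apply: (@addnI #|G|); rewrite [in RHS]cG -cE -!sum1_card.
rewrite [RHS](bigID (mem G)) /=; congr (_ + _).
  apply: eq_bigl => e; rewrite andbC.
  by case: imsetP => //= -[i _ ->]; case: (spine_edge (ltn_ord i)) => ->.
rewrite big_mkcond [in RHS]big_mkcond /=; apply: eq_bigr => e _.
case: (e \in edges H) => //=.
case: imsetP => [[i _ ->]|none] /=.
  by case: off_spineP => // /(_ i (ltn_ord i)); rewrite eqxx.
case: off_spineP => // -[] j jd; apply/eqP => ej.
by apply: none; exists (Ordinal jd).
Qed.

Lemma degree_gt1 e f v :
  e \in edges H -> f \in edges H -> v \in e -> v \in f -> e != f ->
  non_pendant H v.
Proof.
by move=> eH fH ve vf ef; apply/card_gt1P; exists e, f; rewrite !inE eH fH.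
Qed.

(** An edge with a child off the spine has a count exceeding its own contribution, so by tightness
    it is [g p] and carries all n edges. If there is no such edge, every edge off the spine is
    topped at the root. *)
Lemma extremal_counts (n : nat) (N : {set V} -> nat) :
  0 < n -> #|edges H| = d + n ->
  (forall e, e \in edges H -> #|[set v in e | non_pendant H v]| <= 2) ->
  (forall e, e \in edges H -> N e = (height e == 0) +
        \sum_(f in edges H | (top f \in e) && (top f != top e)) N f) ->
  \sum_(e in edges H | top e == x p) N e = \sum_(e in edges H) (height e == 0 : nat) ->
  (forall e, e \in edges H ->
     N e = (height e == 0) \/ height e = p.+1 /\ N e = n) ->
  (forall f, f \in edges H -> height f = 0 -> x p \in f) \/
  (forall f, f \in edges H -> height f = 0 -> x p.+1 \in f).
Proof.
have [topP _ parent _ rootP] := rootedH.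
move=> n0 cE two NE total tight.
have off_pos f : f \in edges H -> height f = 0 -> 0 < N f.
  by move=> fH f0; rewrite NE // f0.
have parent_count f : f \in edges H -> height f = 0 -> top f != x p ->
    exists e, [/\ e \in edges H, top f \in e, top f != top e & (height e == 0) < N e].
  move=> fH f0 fc; have [e [eH fe ft]] := parent _ fc; exists e; split=> //.
  rewrite NE // (bigD1 f) ?fH ?fe ?ft //=.
  by have := off_pos f fH f0; nat_lia.
have [/existsP[e /andP[eH Ne]]|/existsPn none] :=
    boolP [exists e, (e \in edges H) && (N e != (height e == 0))].
  right=> f fH f0.
  have pd : p < d by nat_lia.
  have p1d : p.+1 < d by nat_lia.
  have [pH p1 p2] := spine_edge pd; have [qH q1 q2] := spine_edge p1d.
  have top_p : top (g p) = x p by rewrite spine_top // ltnn.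
  have big e' : e' \in edges H -> N e' != (height e' == 0) -> e' = g p /\ N e' = n.
    move=> e'H Ne'; have [eq|[hp Nn]] := tight e' e'H.
      by rewrite eq eqxx in Ne'.
    have [|j jd ej] := @height_gt0 e'; first by rewrite hp.
    split=> //; rewrite ej; congr g.
    by move: hp; rewrite ej height_spine //; move: p_gt0 jd; clear; lia.
  have [ep Nn] := big e eH Ne; rewrite ep in Nn.
  have [fc|fc] := eqVneq (top f) (x p).
    move: total; rewrite (card_off_spine cE) (bigD1 (g p)) ?pH ?top_p ?eqxx //=.
    rewrite (bigD1 f) /= ?fH ?fc ?eqxx //=; last first.
      by apply/eqP => fp; move: f0; rewrite fp height_spine //; nat_lia.
    by have := off_pos f fH f0; nat_lia.
  have [e1 [e1H fe1 ft1 Ne1]] := parent_count f fH f0 fc.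
  have [e1p _] : e1 = g p /\ N e1 = n by apply: big; rewrite // gtn_eqF.
  rewrite e1p top_p in fe1 ft1.
  (* [x p], [x p.+1] and [top f] are non-pendant vertices of [g p], which has at most two, and
     [top f] is not the root. *)
  have xt : x p.+1 = top f.
    apply/eqP/negPn/negP => xt; have := two _ pH; apply/negP; rewrite -ltnNge.
    apply/card_gt2P; exists (x p), (x p.+1), (top f).
    have fp : f != g p.
      by apply/eqP => fp; move: f0; rewrite fp height_spine //; nat_lia.
    have pq : g p != g p.+1 by apply/eqP => /(spine_edge_inj pd p1d); nat_lia.
    have pp : g p != g p.-1.
      by apply/eqP => /(spine_edge_inj pd); have := p_gt0; nat_lia.
    have [|rH _ r2] := @spine_edge p.-1; first by nat_lia.
    rewrite prednK // in r2.
    have x01 : x p != x p.+1 by apply: spine_neq; nat_lia.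
    rewrite !inE p1 p2 fe1 xt x01 ft1 (degree_gt1 pH rH) //.
    by rewrite (degree_gt1 pH qH) // (degree_gt1 pH fH) // ?(topP f fH).1 // eq_sym.
  by rewrite xt; exact: (topP f fH).1.
left=> f fH f0; have [<-|fc] := eqVneq (top f) (x p); first exact: (topP f fH).1.
have [e [eH fe ft Ne]] := parent_count f fH f0 fc.
by have := none e; rewrite eH /= gtn_eqF.
Qed.

End RootedSpine.

(** * The upper bound *)

Local Open Scope ring_scope.

(** The weights compare T with the tree in which all edges off the spine hang at the root; the
    vertex conditions are tight by construction, so the content lies in the edge conditions. *)
Lemma hypertree_bound (R : realType) (V : finType) (H : hypergraph V)
    (m n p : nat) (x : nat -> V) (g : nat -> {set V})
    (top : {set V} -> V) (depth : V -> nat) (s : R) :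
  let M := m.-1%:R in let t := branch_weight M s in
  (1 < m)%N -> (0 < n)%N -> (0 < p)%N -> uniform H m ->
  (forall e, e \in edges H -> (#|[set v in e | non_pendant H v]| <= 2)%N) ->
  spine H (2 * p + 1) x g -> rooted H (x p) top depth ->
  #|edges H| = (2 * p + 1 + n)%N ->
  M + 3 <= s -> t p + t p.+1 + n%:R * t 1%N = s - 1 ->
  lambda1 R m H <= (s - 1) / M /\
  (connected_hypergraph H -> lambda1 R m H = (s - 1) / M ->
   let off := spine_height (2 * p + 1) g in
   (forall f, f \in edges H -> off f = 0%N -> x p \in f) \/
   (forall f, f \in edges H -> off f = 0%N -> x p.+1 \in f)).
Proof.
move=> M t m1 n0 p0 unif two xg rootedH cE sM bal.
have M1 : 1 <= M by rewrite /M ler1n; lia.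
pose h := spine_height (2 * p + 1) g.
have [N [NE Ntot Nle]] := subtree_counts (fun e => (h e == 0%N) : nat) rootedH.
have wn := card_off_spine p0 xg cE.
have [topP _ parent uniq rootP] := rootedH.
have t0 : t 0%N = 0 by exact: branch_weight0.
have tge k : 0 <= t k by exact: branch_weight_ge0.
have tlt i j : (i < j)%N -> t i < t j by exact: branch_weight_ltn.
have t1 : 0 < t 1%N by rewrite -t0; exact: tlt.
(* G e is the weight allotted to the branch starting with e: that of its part   *)
(* of the spine, every other edge counting as a pendant edge at its root.      *)
pose G e := t (h e) + (N e)%:R * t 1%N.
pose S v := \sum_(e in edges H | top e == v) G e.
have G0 e : 0 <= G e by rewrite addr_ge0 ?mulr_ge0 // ltW.
(* At a vertex other than the root, the edge leading towards the root receives whatever the child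
   edges leave of s - 1. *)
pose c v e := if v == top e then 1 + G e else s - S v.
pose cnt (e : {set V}) := (\sum_(f in edges H | (top f \in e) && (top f != top e)) N f)%N.
have pred_max k : ((maxn k 1).-1 = k.-1)%N by lia.
have Sle v e : e \in edges H -> v \in e -> v != top e ->
    S v <= t (h e).-1 + (cnt e)%:R * t 1%N.
  move=> eH ve vt.
  apply: (@le_trans _ _
    (\sum_(f in edges H | (top f \in e) && (top f != top e)) G f)); last first.
    rewrite big_split /= -mulr_suml -natr_sum lerD2r.
    exact: (child_height_sum p0 xg rootedH).
  rewrite /S [leLHS]big_mkcondr [leRHS]big_mkcondr /=; apply: ler_sum => f _.
  by case: eqP => [->|_]; rewrite ?ve ?vt //; case: ifP.
have cntN e : e \in edges H -> N e = ((h e == 0) + cnt e)%N by exact: NE.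
have Nn e : e \in edges H -> (N e <= n)%N by move=> eH; rewrite -wn; exact: Nle.
(* This is the condition a + z <= b of [inv_sum_le]. An edge off the spine acts as a branch of
   height 1, whence [maxn (h e) 1]. By monotonicity the bound is strict unless h = p + 1. *)
have room e : e \in edges H ->
    t (maxn (h e) 1).-1 + t (maxn (h e) 1) + (cnt e)%:R * t 1%N <= s - 1 /\
    (t (maxn (h e) 1).-1 + t (maxn (h e) 1) + (cnt e)%:R * t 1%N = s - 1 ->
     h e = p.+1 /\ N e = n).
  move=> eH; rewrite -bal; have := cntN e eH; have := Nn e eH.
  have strict (y z : R) (Q : Prop) : y < z -> y <= z /\ (y = z -> Q).
    by move=> yz; split=> [|yz']; [exact: ltW | rewrite yz' ltxx in yz].
  have := height_le p0 xg e; rewrite -/h.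
  have [h0|hpos] := posnP (h e) => hp.
    rewrite h0 max0n => Nen Ne; rewrite /= t0.
    have : (1 + (cnt e)%:R) * t 1%N <= n%:R * t 1%N.
      by rewrite ler_pM2r // -(natrD _ 1) ler_nat -Ne.
    have := tlt 0%N p p0; have := tge p.+1; rewrite t0 => a b c'.
    by apply: strict; lra.
  rewrite (maxn_idPl hpos) add0n => + Ne; rewrite Ne => cn.
  have cn' : (cnt e)%:R * t 1%N <= n%:R * t 1%N by rewrite ler_pM2r // ler_nat.
  have [hlt|hgt|heq] := ltngtP (h e) p.+1; [|by lia|].
    have a : t (h e).-1 < t p by apply: tlt; lia.
    have b : t (h e) < t p.+1 by apply: tlt; lia.
    by apply: strict; lra.
  rewrite heq /=; split=> [|eq]; first by lra.
  split=> //; apply/eqP; rewrite -(eqr_nat R) -(inj_eq (mulIf (lt0r_neq0 t1))).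
  by apply/eqP; lra.
have Spos v e : e \in edges H -> v \in e -> v != top e -> 0 < s - S v.
  move=> eH ve vt; have := Sle v e eH ve vt; have := (room e eH).1.
  have := tge (maxn (h e) 1).
  by rewrite pred_max; lra.
have cpos e v : e \in edges H -> v \in e -> 0 < c v e.
  move=> eH ve; rewrite /c; case: eqP => [_|/eqP vt]; last exact: Spos ve vt.
  by have := G0 e; lra.
have top_np e : e \in edges H -> non_pendant H (top e).
  move=> eH; have te := (topP e eH).1.
  have [tc|tc] := eqVneq (top e) (x p); last first.
    have [f [fH tf nt]] := parent _ tc; apply: (degree_gt1 eH fH te tf).
    by apply: contraNneq nt => ->.
  have qd : (p.-1 < 2 * p + 1)%N by lia.
  have pd : (p < 2 * p + 1)%N by lia.
  have [qH _ q2] := spine_edge xg qd; have [pH p1 _] := spine_edge xg pd.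
  rewrite tc; rewrite prednK // in q2.
  apply: (degree_gt1 qH pH q2 p1).
  by apply/eqP => /(spine_edge_inj xg qd pd); move: p0; clear; lia.
(* The top is non-pendant, so at most one other vertex v of [e] has child edges; the remaining M - 1
   vertices contribute 1 / s each. If there is none, any v other than the top will do. *)
have edge_sum e : e \in edges H -> exists2 v, [/\ v \in e & v != top e] &
    \sum_(w in e) (c w e)^-1 = (1 + G e)^-1 + (M - 1) / s + (s - S v)^-1.
  move=> eH; have te := (topP e eH).1.
  have [v [ve vt vP]] : exists v, [/\ v \in e, v != top e &
      forall w, w \in e -> w != top e -> w != v -> S w = 0].
    have Sz w : w \in e -> w != top e -> ~~ non_pendant H w -> S w = 0.
      move=> we wt np; apply: big1 => f /andP[fH /eqP tf].
      case/negP: np; apply: (degree_gt1 eH fH we); first by rewrite -tf (topP f fH).1.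
      by apply: contraNneq wt => ->; rewrite tf.
    have [/existsP[v /and3P[ve vt vnp]]|/existsPn none] :=
        boolP [exists v, [&& v \in e, v != top e & non_pendant H v]].
      exists v; split=> // w we wt wv; apply: Sz => //; apply/negP => wnp.
      have := two e eH; apply/negP; rewrite -ltnNge.
      apply/card_gt2P; exists (top e), v, w.
      by rewrite !inE te ve we vnp wnp top_np // wt (eq_sym v w) wv eq_sym vt.
    have : (1 < #|e|)%N by rewrite unif.
    case/card_gt1P => a [b [ae be ab]].
    have [v [ve vt]] : exists v, v \in e /\ v != top e.
      by have [at_|] := eqVneq a (top e); [exists b; rewrite -at_ eq_sym|exists a].
    exists v; split=> // w we wt _; apply: Sz => //; apply/negP => wnp.
    by have := none w; rewrite we wt wnp.
  exists v => //; rewrite (bigD1 (top e)) //= (bigD1 v) ?ve //=.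
  rewrite /c eqxx (negPf vt) -addrA; congr (_ + _); rewrite addrC; congr (_ + _).
  transitivity (\sum_(w in e :\ top e :\ v) s^-1).
    apply: eq_big => [w|w /andP[/andP[we wt] wv]].
      by rewrite !inE [RHS]andbC [(w != top e) && _]andbC.
    by rewrite (negPf wt) vP // subr0.
  rewrite sumr_const -mulr_natl; congr (_ * _).
  have := cardsD1 v (e :\ top e); have := cardsD1 (top e) e.
  rewrite unif // te !inE ve vt /= /M => -> ->.
  by rewrite !add1n /= -natr1 addrK.
have GE e : e \in edges H -> G e = t (maxn (h e) 1) + (cnt e)%:R * t 1%N.
  move=> eH; rewrite /G cntN //; have [->|hpos] := posnP (h e).
    by rewrite t0 natrD mulrDl mul1r add0r.
  by rewrite (maxn_idPl hpos) add0n.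
(* The bare-branch identity for t_k and t_(k-1) has sum 1. Adding z to 1 + t_k and removing it from
   s - t_(k-1) does not increase the sum; equality means z = 0 or equality in [room]. *)
have tight e : e \in edges H -> \sum_(v in e) (c v e)^-1 <= 1 /\
    (\sum_(v in e) (c v e)^-1 = 1 ->
     N e = (h e == 0%N) \/ h e = p.+1 /\ N e = n).
  move=> eH; have [v [ve vt] ->] := edge_sum e eH; rewrite GE //.
  have [r1 r2] := room e eH; have := Sle v e eH ve vt; rewrite -pred_max.
  set k := maxn (h e) 1; rewrite -/k in r1 r2.
  set z := (cnt e)%:R * t 1%N; rewrite -/z in r1 r2 => Sv.
  have k0 : (0 < k)%N by exact: leq_maxr.
  have z0 : 0 <= z by rewrite mulr_ge0 // ltW.
  have := tge k => tk.
  have [] := @inv_sum_le _ (1 + t k) (s - t k.-1) z; [by lra|by []|by lra|].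
  have [+ _] := branch_weightS k.-1 M1 sM; rewrite prednK // -/t => ek le1 eq1.
  have le2 : (s - S v)^-1 <= (s - t k.-1 - z)^-1.
    by rewrite lef_pV2 ?posrE; lra.
  rewrite addrA; split=> [|eq]; first by lra.
  have [|zz|kz] := eq1; first by lra.
    left; rewrite cntN //; move/eqP: zz; rewrite mulf_eq0 (gt_eqF t1) orbF.
    by rewrite pnatr_eq0 => /eqP ->; rewrite addn0.
  by right; apply: r2; lra.
have vertex v : \sum_(e in edges H | v \in e) (c v e - 1) <= s - 1.
  have topE w e : e \in edges H -> top e = w -> w \in e.
    by move=> eH <-; case: (topP e eH).
  have [->|vc] := eqVneq v (x p).
    have -> : \sum_(e in edges H | x p \in e) (c (x p) e - 1) =
        \sum_(e in edges H | top e == x p) G e.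
      apply: eq_big => [e|e /andP[eH ve]]; last first.
        by rewrite /c rootP // eqxx addrC addKr.
      case eH: (e \in edges H) => //=.
      by apply/idP/eqP => [/(rootP e eH)|/(topE _ _ eH)].
    rewrite big_split /= (root_height_sum p0 xg rootedH t0) -mulr_suml -natr_sum.
    by rewrite Ntot wn bal.
  have [e [eH ve vt]] := parent v vc.
  rewrite (bigD1 e) ?eH ?ve //= {1}/c (negPf vt).
  have -> : \sum_(i | (i \in edges H) && (v \in i) && (i != e)) (c v i - 1) = S v.
    apply: eq_big => [f|f /andP[/andP[fH vf] fe]].
      case fH: (f \in edges H) => //=.
      apply/andP/eqP => [[vf fe]|tf].
        by apply/esym/eqP/negPn/negP => vtf; case/eqP: fe; exact: uniq vtf vt.
      split; first exact: topE tf.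
      by apply: contraNneq vt => <-; rewrite tf.
    rewrite /c; case: eqP => [_|/eqP vtf]; first by rewrite addrC addKr.
    by case/eqP: fe; exact: uniq vtf vt.
  by lra.
have V0 : (0 < #|V|)%N by apply/card_gt0P; exists (x p).
have [le eqP] := weighted_incidence_bound cpos (fun e eH => (tight e eH).1) vertex m1 V0.
split=> // conn eq; apply: (extremal_counts p0 xg rootedH n0 cE two NE Ntot).
by move=> e eH; apply: (tight e eH).2; exact: eqP.
Qed.

Local Close Scope ring_scope.

(** * The extremal hypertree *)

(** Each vertex other than the root is a non-top vertex of exactly one edge, and each edge has m - 1
    of them. *)
Lemma rooted_card (V : finType) (H : hypergraph V) (m : nat) (c : V) top depth :
  rooted H c top depth -> uniform H m -> #|V| = (#|edges H| * m.-1).+1.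
Proof.
move=> [topP _ parent uniq rootP] unif.
rewrite (cardD1 c) inE add1n; congr _.+1; rewrite -[LHS]sum1_card.
transitivity (\sum_(v | v != c) \sum_(e in edges H | (v \in e) && (v != top e)) 1).
  apply: eq_big => [v|v]; first by rewrite !inE andbT.
  rewrite !inE andbT => vc; have [e [eH ve vt]] := parent v vc.
  rewrite (big_pred1 e) // => f; apply/idP/eqP => [/and3P[fH vf vtf]|->].
    exact: uniq vtf vt.
  by rewrite eH ve vt.
rewrite (exchange_big_dep (mem (edges H))) /=; last by move=> v e _ /andP[].
rewrite -sum_nat_const; apply: eq_bigr => e eH.
rewrite sum1_card -(unif e eH) (cardsD1 (top e) e) (topP e eH).1 add1n /=.
apply: eq_card => v; rewrite !inE; apply/and4P/andP => [[_ _ ve vt] //|[vt ve]].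
by split=> //; apply: contraNneq vt => vc; rewrite vc rootP // -vc.
Qed.

(** A surjection from W onto a set at least as large is a bijection, and its inverse is the
    isomorphism; injectivity is thus replaced by the vertex count of [rooted_card]. *)
Lemma hypergraph_iso_of_onto (V W : finType) (H : hypergraph V)
    (K : hypergraph W) (f : W -> V) :
  #|W| <= #|V| -> (forall v, exists w, f w = v) ->
  (forall e, e \in edges K -> f @: e \in edges H) ->
  (forall e, e \in edges H -> exists2 e', e' \in edges K & e = f @: e') ->
  hypergraph_iso H K.
Proof.
move=> cWV /fin_all_exists[h fh] KH HK.
have hbij : bijective h by apply: inj_card_bij cWV; apply: can_inj fh.
have hf w : h (f w) = w.
  by have [h' h'h hh'] := hbij; apply: (can_inj hh'); rewrite -[RHS]fh hh' h'h.
have hfE (e : {set W}) : h @: (f @: e) = e.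
  by rewrite -imset_comp (eq_imset _ (hf : h \o f =1 id)) imset_id.
exists h => //; apply/setP => e'; apply/imsetP/idP => [[e eH ->]|e'K].
  by have [e'' e''K ->] := HK e eH; rewrite hfE.
by exists (f @: e'); rewrite ?hfE //; exact: KH.
Qed.

Definition pendants_at (p n : nat) (i : nat) : nat := if i == p + 1 then n else 0.

Lemma card_pendants (d p n : nat) :
  0 < p -> p < d -> #|{: {i : 'I_d.-1 & 'I_(pendants_at p n i.+2)}}| = n.
Proof.
move=> p0 pd; rewrite card_tagged sumnE big_map big_enum /=.
have pd' : p.-1 < d.-1 by lia.
rewrite (bigD1 (Ordinal pd')) //= card_ord /pendants_at big1 => [|i ip].
  by rewrite (_ : _ == _) ?addn0 //; lia.
rewrite card_ord; case: eqP => // ip'; case/eqP: ip; apply: val_inj => /=; lia.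
Qed.

Lemma tag_pendants (d p n : nat) (a : {i : 'I_d.-1 & 'I_(pendants_at p n i.+2)}) :
  (tag a).+1 = p.
Proof.
case: a => i [j]; rewrite /pendants_at /=; case: eqP => // ip _; lia.
Qed.

Lemma spine_iso (V : finType) (H : hypergraph V) (m d p n : nat)
    (x : nat -> V) (g : nat -> {set V}) (top : {set V} -> V) (depth : V -> nat) :
  1 < m -> 0 < p -> p < d -> uniform H m ->
  spine H d x g -> rooted H (x p) top depth -> #|edges H| = d + n ->
  (forall f, f \in edges H -> (forall j, j < d -> g j != f) -> x p \in f) ->
  hypergraph_iso H (Td m d (pendants_at p n)).
Proof.
move=> m1 p0 pd unif [xg gI xI] rootedH cE offP.
have cV := rooted_card rootedH unif.
have [_ _ parent _ _] := rootedH.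
pose A : finType := {i : 'I_d.-1 & 'I_(pendants_at p n i.+2)}.
have cA : #|A| = n by exact: card_pendants.
pose O := edges H :\: [set g i | i : 'I_d].
have cO : #|O| = n.
  have gI' : injective (fun i : 'I_d => g i).
    by move=> i j /(gI _ _ (ltn_ord i) (ltn_ord j)) /val_inj.
  rewrite cardsD (setIidPr _) ?card_imset // ?card_ord ?cE ?addKn //.
  by apply/fintype.subsetP => _ /imsetP[i _ ->]; case: (xg i (ltn_ord i)).
have OP f : f \in O -> f \in edges H /\ x p \in f.
  rewrite inE => /andP[fg fH]; split=> //; apply: offP => // j jd.
  apply: contraNneq fg => <-; exact: (imset_f (fun i : 'I_d => g i) (x := Ordinal jd)).
pose off (a : A) := nth set0 (enum O) (enum_rank a).
have offO a : off a \in O by rewrite -mem_enum mem_nth // -cardE cO -cA.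
have off_onto f : f \in O -> exists a, off a = f.
  move=> fO; have lt : index f (enum O) < #|A|.
    by rewrite cA -cO cardE index_mem mem_enum.
  by exists (enum_val (Ordinal lt)); rewrite /off enum_valK nth_index // mem_enum.
(* [L i] lists [g i] without its last spine vertex, so position i (m - 1) + r of the loose path goes
   to entry r of [L i]. The final position d (m - 1) goes to the head [x d] of [L d], whatever [g d]
   is. *)
pose L i := x i :: enum (g i :\ x i :\ x i.+1).
have M0 : 0 < m.-1 by lia.
have sizeL i : i < d -> size (L i) = m.-1.
  move=> id_; have [gH g1 g2] := xg i id_.
  have ne : x i.+1 != x i by apply/eqP => /(xI _ _ id_ (ltnW id_)); lia.
  have := cardsD1 (x i.+1) (g i :\ x i); have := cardsD1 (x i) (g i).
  by rewrite !inE g1 g2 ne unif //= -cardE /=; lia.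
have sizeO f : f \in O -> size (enum (f :\ x p)) = m.-1.
  move=> /OP[fH xf]; rewrite -cardE; have := cardsD1 (x p) f.
  by rewrite xf unif //; lia.
pose phi (y : 'I_(d * m.-1).+1 + A * 'I_m.-1) : V :=
  match y with
  | inl y => nth (x (y %/ m.-1)) (L (y %/ m.-1)) (y %% m.-1)
  | inr (a, j) => nth (x p) (enum (off a :\ x p)) j
  end.
have phiL i r (y : 'I_(d * m.-1).+1) : r < m.-1 -> y = i * m.-1 + r :> nat ->
    phi (inl y) = nth (x i) (L i) r.
  by move=> lt yE; rewrite /= yE divnMDl // divn_small // addn0 modnMDl modn_small.
have phi0 i (y : 'I_(d * m.-1).+1) : y = i * m.-1 :> nat -> phi (inl y) = x i.
  by move=> yE; rewrite (phiL i 0) ?addn0.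
have img_path (i : 'I_d) : phi @: (inl @: loose_path_edge m i) = g i.
  have [gH g1 g2] := xg i (ltn_ord i).
  apply/setP => w; apply/imsetP/idP => [[_ /imsetP[y yi ->] ->]|wg].
    move: yi; rewrite inE => /andP[y1 y2].
    have [yE|yE] := eqVneq (y : nat) (i.+1 * m.-1); first by rewrite (phi0 i.+1).
    have lt : y - i * m.-1 < m.-1 by lia.
    rewrite (phiL i (y - i * m.-1)) ?subnKC //.
    have /(mem_nth (x i)) : y - i * m.-1 < size (L i) by rewrite sizeL.
    by rewrite inE mem_enum !inE => /orP[/eqP ->|/and3P[]].
  have bound (r : nat) : r <= m.-1 -> i * m.-1 + r < (d * m.-1).+1.
    have := ltn_ord i; nia.
  have inP (r : nat) (rM : r <= m.-1) :
      (inl (Ordinal (bound r rM)) : 'I_(d * m.-1).+1 + A * 'I_m.-1)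
        \in [set inl z | z in loose_path_edge m i].
    by apply: imset_f; rewrite inE /= mulSn; lia.
  have [->|wx] := eqVneq w (x i.+1).
    exists (inl (Ordinal (bound _ (leqnn _)))); first exact: inP.
    by rewrite (phi0 i.+1) //= mulSn addnC.
  have wL : w \in L i by rewrite inE mem_enum !inE wx wg /= andbT orbN.
  have lt : index w (L i) < m.-1 by rewrite -(sizeL i) // index_mem.
  exists (inl (Ordinal (bound _ (ltnW lt)))); first exact: inP.
  by rewrite (phiL i (index w (L i))) // nth_index.
have img_off (a : A) : phi @: (attached_edge m
    (fun a : A => loose_path_vertex m d (tag a).+2) a) = off a.
  have /OP[oH xo] := offO a.
  have xpE : phi (inl (loose_path_vertex m d (tag a).+2)) = x p.
    apply: phi0; rewrite /loose_path_vertex /= (tag_pendants a) inordK //.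
    by rewrite ltnS leq_mul2r ltnW ?orbT.
  rewrite /attached_edge imsetU1 xpE -imset_comp.
  apply/setP => w; rewrite in_setU1; apply/orP/idP => [[/eqP -> //|]|wo].
    case/imsetP => j _ -> /=.
    have : nth (x p) (enum (off a :\ x p)) j \in enum (off a :\ x p).
      by rewrite mem_nth // sizeO.
    by rewrite mem_enum !inE => /andP[].
  have [->|wx] := eqVneq w (x p); [by left|right].
  have wL : w \in enum (off a :\ x p) by rewrite mem_enum !inE wx.
  have lt : index w (enum (off a :\ x p)) < m.-1.
    by rewrite -(sizeO _ (offO a)) index_mem.
  by apply/imsetP; exists (Ordinal lt); rewrite //= nth_index.
have edge_img f : f \in edges H ->
    exists2 e', e' \in edges (Td m d (pendants_at p n)) & f = phi @: e'.
  move=> fH; have [/imsetP[i _ fi]|fg] := boolP (f \in [set g i | i : 'I_d]).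
    exists (inl @: loose_path_edge m i); last by rewrite img_path.
    by rewrite inE; apply/orP; left; apply: imset_f; apply: imset_f.
  have [|a <-] := off_onto f; first by rewrite inE fg.
  exists (attached_edge m (fun a : A => loose_path_vertex m d (tag a).+2) a).
    by rewrite inE; apply/orP; right; apply: imset_f.
  by rewrite img_off.
apply: (@hypergraph_iso_of_onto _ _ _ _ phi).
- by rewrite card_sum card_prod !card_ord cA cV cE addSn mulnDl.
- move=> v; have [e eH ve] : exists2 e, e \in edges H & v \in e.
    have [->|vc] := eqVneq v (x p); first by have [? ? _] := xg p pd; exists (g p).
    by have [e [eH ve _]] := parent v vc; exists e.
  by have [e' _ ee] := edge_img e eH; move: ve; rewrite ee => /imsetP[w _ ->]; exists w.
- move=> e; rewrite inE => /orP[/imsetP[_ /imsetP[i _ ->] ->]|/imsetP[a _ ->]].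
    by rewrite img_path; case: (xg i (ltn_ord i)).
  by rewrite img_off; case: (OP _ (offO a)).
- exact: edge_img.
Qed.

(** * An explicit eigenvector on T_d(c_(p+1) = n) *)

Local Open Scope ring_scope.

(** The equality counterpart of [adjacent_sum_le]: two vertices share at most one index, so each
    neighbour is counted once. *)
Lemma indexed_adjacent_sum (R : realType) (V J : finType) (H : hypergraph V)
    (E : J -> {set V}) (y : V -> R) (v : V) :
  (forall e, (e \in edges H) = (e \in [set E j | j : J])) ->
  (forall i j u w, u != w -> u \in E i -> w \in E i -> u \in E j -> w \in E j ->
     i = j) ->
  \sum_(w | adjacent H v w) y w =
  \sum_(j | v \in E j) (\sum_(w in E j) y w - y v).
Proof.
move=> edgesE uniq.
transitivity (\sum_(j | v \in E j) \sum_(w | w != v) (if w \in E j then y w else 0)).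
  rewrite exchange_big /= big_mkcond [RHS]big_mkcond /=; apply: eq_bigr => w _.
  rewrite /adjacent eq_sym; case: eqVneq => //= wv.
  case: existsP => [[e /and3P[]]|none].
    rewrite edgesE => /imsetP[j _ ->] vj wj.
    rewrite (bigD1 j) //= wj big1 ?addr0 // => i /andP[vi ij]; case: ifP => // wi.
    by case/eqP: ij; apply: (uniq i j w v).
  rewrite big1 // => j vj; case: ifP => // wj; case: none; exists (E j).
  by rewrite edgesE vj wj imset_f.
apply: eq_bigr => j vj; rewrite -big_mkcondr [in RHS](bigD1 v) //= addrAC subrr add0r.
by apply: eq_bigl => w; rewrite andbC.
Qed.

Lemma sum_around (R : realType) (d q : nat) (F : nat -> R) :
  \sum_(i < d | (i == q :> nat) || (i.+1 == q)) F i =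
  (if (q < d)%N then F q else 0) + (if (0 < q <= d)%N then F q.-1 else 0).
Proof.
rewrite (bigID (fun i : 'I_d => (i == q :> nat))) /=; congr (_ + _).
  rewrite -(big_ord1_eq +%R F); apply: eq_bigl => i.
  by rewrite andb_idl // => ->.
case: q => [|q] /=.
  by rewrite big1 // => i /andP[]; rewrite orbF => ->.
rewrite -(big_ord1_eq +%R F); apply: eq_bigl => i.
by rewrite eqSS; lia.
Qed.

Lemma sum_interval (R : realType) (d M i : nat) (F : nat -> R) :
  (i < d)%N -> (0 < M)%N ->
  \sum_(k < (d * M).+1 | (i * M <= k <= i.+1 * M)%N) F k =
  F (i * M)%N + \sum_(r < M.-1) F (i * M + r.+1)%N + F (i.+1 * M)%N.
Proof.
move=> id_ M0.
transitivity (\sum_(r < M.+1) F (i * M + r)%N); last first.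
  case: M M0 => // M _; rewrite big_ord_recr big_ord_recl /= addn0.
  by rewrite mulSn addnC.
rewrite -(big_mkord (fun k => (i * M <= k <= i.+1 * M)%N) F).
rewrite -(big_mkord xpredT (fun r => F (i * M + r)%N)).
rewrite (@big_cat_nat _ _ _ (i * M)%N) //=; last by nia.
rewrite big1_seq ?add0r => [|k]; last first.
  by rewrite mem_index_iota => /andP[/andP[h _]]; lia.
rewrite (@big_cat_nat _ _ _ (i * M + M.+1)%N) //=; [|by lia|by nia].
rewrite [X in _ + X]big1_seq ?addr0 => [|k]; last first.
  by rewrite mem_index_iota => /andP[/andP[_ h]]; rewrite mulSn in h; lia.
rewrite -{1}[(i * M)%N]add0n big_addn addKn big_nat_cond [RHS]big_nat_cond.
apply: eq_big => [r|r _]; last by rewrite addnC.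
by rewrite mulSn; lia.
Qed.

Section TdEigenvector.
Variables (R : realType) (m p n : nat) (s : R).
Hypotheses (m_gt1 : (1 < m)%N) (p_gt0 : (0 < p)%N).
Local Notation M := (m.-1%:R : R).
Local Notation t := (branch_weight M s).
Local Notation d := (2 * p + 1)%N.
Hypothesis sM : M + 3 <= s.
Hypothesis balanced : t p + t p.+1 + n%:R * t 1%N = s - 1.

(* A positive eigenvector on T_d(c_(p+1) = n): branch_value h is its value at  *)
(* the vertex of a branch at distance h from the leaf, up to a scalar.         *)
Fixpoint branch_value (h : nat) : R :=
  if h is h'.+1 then branch_value h' * (s - t h') / (1 + t h'.+1) else 1.

Local Notation Z := branch_value.

(** The sum of the eigenvector over the edge between heights h and h + 1, as value times 1 + ratio
    at the lower end; [branch_edgeS] reads it from the upper end. *)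
Definition branch_edge (h : nat) : R := Z h * (s - t h).

(** Two branches, of heights p and p + 1, are glued at position p and scaled to take the value 1
    there. *)
Definition core_value (i : nat) : R :=
  if (i <= p)%N then Z i / Z p else Z (d - i) / Z p.+1.

Definition core_edge (i : nat) : R :=
  if (i < p)%N then branch_edge i / Z p else branch_edge (d - i.+1) / Z p.+1.

Let M1 : 1 <= M.
Proof. by rewrite ler1n; lia. Qed.

Let s_gt0 : 0 < s.
Proof. by apply: lt_le_trans sM; rewrite ltr_wpDl ?ler0n. Qed.

Let st_gt0 h : 0 < s - t h.
Proof. by have := branch_weight_le h M1 sM; have := s_gt0; lra. Qed.

Let t1_gt0 h : 0 < 1 + t h.+1.
Proof. by have [] := branch_weightS h M1 sM. Qed.

Lemma branch_value_gt0 h : 0 < Z h.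
Proof. by elim: h => //= h IH; rewrite divr_gt0 ?mulr_gt0. Qed.

Lemma branch_edgeS h : branch_edge h = Z h.+1 * (1 + t h.+1).
Proof. by rewrite /branch_edge /= divfK // gt_eqF. Qed.

Arguments branch_value : simpl never.

Lemma branch_edge_sum h : Z h.+1 + (M - 1) * (branch_edge h / s) + Z h = branch_edge h.
Proof.
have [e _] := branch_weightS h M1 sM.
rewrite -[RHS]mulr1 -[X in _ = _ * X]e !mulrDr.
congr (_ + _ + _); first by rewrite mulrCA.
by rewrite /branch_edge mulfK // gt_eqF.
Qed.

Lemma core_value_right i : (p <= i)%N -> core_value i = Z (d - i) / Z p.+1.
Proof.
rewrite leq_eqVlt /core_value => /predU1P[<-|pi]; last by rewrite leqNgt pi.
rewrite leqnn (_ : (d - p = p.+1)%N); last by lia.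
by rewrite !divff // gt_eqF // branch_value_gt0.
Qed.

Lemma core_value_mid : core_value p = 1.
Proof. by rewrite /core_value leqnn divff // gt_eqF // branch_value_gt0. Qed.

Lemma core_edge_sum i : (i < d)%N ->
  core_value i + (M - 1) * (core_edge i / s) + core_value i.+1 = core_edge i.
Proof.
move=> id_.
have scale (a b c e z : R) : a + b * (c / s) + e = c ->
    e / z + b * (c / z / s) + a / z = c / z /\
    a / z + b * (c / z / s) + e / z = c / z.
  move=> h; have hz : (a + b * (c / s) + e) / z = c / z by rewrite h.
  by split; rewrite -[RHS]hz; ring.
rewrite /core_edge; case: ltnP => ip.
  rewrite /core_value (ltnW ip) ip.
  by have [] := scale _ _ _ _ (Z p) (branch_edge_sum i).
rewrite !core_value_right ?(leqW ip) // (_ : (d - i = (d - i.+1).+1)%N); last by lia.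
by have [] := scale _ _ _ _ (Z p.+1) (branch_edge_sum (d - i.+1)).
Qed.

(** The eigenvalue equation at a path vertex. Away from p it is t_h + (s - 1 - t_h) = s - 1, and at
    p it is the balance equation. *)
Lemma core_vertex_sum q : (q <= d)%N ->
  (if (q < d)%N then core_edge q - core_value q else 0) +
  (if (0 < q <= d)%N then core_edge q.-1 - core_value q else 0) +
  (if q == p then n%:R * t 1%N else 0) = (s - 1) * core_value q.
Proof.
move=> qd.
have t0 : t 0%N = 0 by exact: branch_weight0.
have up h z : branch_edge h / z - Z h / z = (s - t h - 1) * (Z h / z).
  by rewrite /branch_edge; ring.
have down h z : branch_edge h / z - Z h.+1 / z = t h.+1 * (Z h.+1 / z).
  by rewrite branch_edgeS; ring.
have [qp|pq|qp] := ltngtP q p.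
- have -> : (q < d)%N by lia.
  have cq : core_value q = Z q / Z p by rewrite /core_value ltnW.
  rewrite addr0 qd andbT cq {1}/core_edge qp up; case: q => [|q] in qp qd cq *.
    by rewrite /= t0; ring.
  by rewrite /= /core_edge (ltnW qp) down; ring.
- have q0 : (0 < q)%N by lia.
  rewrite addr0 q0 qd /= (core_value_right (ltnW pq)).
  rewrite [core_edge q.-1]/core_edge prednK // [(q <= p)%N]leqNgt pq /= up.
  have [qd'|dq] := ltnP q d; last first.
    have -> : (d - q = 0)%N by lia.
    by rewrite t0; ring.
  rewrite /core_edge ltnNge (ltnW pq) /= (_ : (d - q = (d - q.+1).+1)%N); last by lia.
  by rewrite down; ring.
- rewrite qp core_value_mid /core_edge ltnn (_ : (p < d)%N); last by lia.
  rewrite p_gt0 (_ : (p <= d)%N) /=; last by lia.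
  rewrite prednK // leqnn (_ : (d - p.+1 = p)%N); last by lia.
  have edge h : branch_edge h / Z h.+1 = 1 + t h.+1.
    by rewrite branch_edgeS mulrAC divff ?mul1r // gt_eqF // branch_value_gt0.
  by have := edge p.-1; rewrite prednK // => ->; rewrite edge -balanced; ring.
Qed.

Let T := Td m d (pendants_at p n).
Let A : finType := {i : 'I_d.-1 & 'I_(pendants_at p n i.+2)}.
Let W : finType := ('I_(d * m.-1).+1 + A * 'I_m.-1)%type.

(** A vertex of degree one has ratio s - 1, so its value is the sum over its edge divided by s. *)
Definition Td_value (w : W) : R :=
  match w with
  | inl k => if (k %% m.-1 == 0)%N then core_value (k %/ m.-1)
             else core_edge (k %/ m.-1) / s
  | inr _ => (1 + t 1%N) / s
  end.

Definition Td_edge (j : 'I_d + A) : {set W} :=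
  match j with
  | inl i => inl @: loose_path_edge m i
  | inr a => attached_edge m (fun a : A => loose_path_vertex m d (tag a).+2) a
  end.

Let M_gt0 : (0 < m.-1)%N.
Proof. by lia. Qed.

Lemma pendant_vertexE (a : A) : loose_path_vertex m d (tag a).+2 = (p * m.-1)%N :> nat.
Proof.
rewrite /loose_path_vertex (tag_pendants a) inordK // ltnS leq_mul2r.
by apply/orP; right; lia.
Qed.

Lemma mem_Td_edge_path (i : 'I_d) (k : 'I_(d * m.-1).+1) :
  ((inl k : W) \in Td_edge (inl i)) = (i * m.-1 <= k <= i.+1 * m.-1)%N.
Proof. by rewrite mem_imset ?inE // => ? ? []. Qed.

Lemma mem_Td_edge_pendant_path (i : 'I_d) (z : A * 'I_m.-1) :
  ((inr z : W) \in Td_edge (inl i)) = false.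
Proof. by apply/negP => /imsetP[]. Qed.

Lemma mem_Td_edge_attached (a : A) (k : 'I_(d * m.-1).+1) :
  ((inl k : W) \in Td_edge (inr a)) = (k == (p * m.-1)%N :> nat).
Proof.
rewrite !inE -(pendant_vertexE a); case: eqP => [[->]|kp] /=; first by rewrite eqxx.
rewrite (_ : _ == _ = false); first by apply/negP => /imsetP[].
by apply/eqP => /val_inj kp'; case: kp; rewrite kp'.
Qed.

Lemma mem_Td_edge_pendant (a b : A) (j : 'I_m.-1) :
  ((inr (b, j) : W) \in Td_edge (inr a)) = (b == a).
Proof.
rewrite !inE /=; apply/imsetP/eqP => [[i _ [-> _]] //|->]; by exists j.
Qed.

Lemma Td_edges e : (e \in edges T) = (e \in [set Td_edge j | j : 'I_d + A]).
Proof.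
apply/idP/imsetP => [|[[i|a] _ ->]]; rewrite inE.
- case/orP => /imsetP[x + ->]; last by exists (inr x).
  by case/imsetP => i _ ->; exists (inl i).
- by apply/orP; left; do 2 apply: imset_f.
- by apply/orP; right; apply: imset_f.
Qed.

Lemma Td_edge_uniq (i j : 'I_d + A) (u w : W) :
  u != w -> u \in Td_edge i -> w \in Td_edge i -> u \in Td_edge j ->
  w \in Td_edge j -> i = j.
Proof.
have path_att (k : 'I_d) (a : A) (y z : W) : y != z -> y \in Td_edge (inl k) ->
    z \in Td_edge (inl k) -> y \in Td_edge (inr a) -> z \in Td_edge (inr a) -> False.
  case: y => [y|y]; last by rewrite mem_Td_edge_pendant_path.
  case: z => [z|z]; last by rewrite mem_Td_edge_pendant_path.
  rewrite !mem_Td_edge_attached => yz _ _ /eqP yp /eqP zp.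
  by case/eqP: yz; congr inl; apply: val_inj; rewrite /= yp.
case: i j => [i|a] [j|b] uw ui wi uj wj; first 1 last.
- by case: (path_att i b u w).
- by case: (path_att j a u w).
- congr inr; case: u uw ui uj => [u|[c k]] uw; last first.
    by rewrite !mem_Td_edge_pendant => /eqP -> /eqP.
  case: w uw wi wj => [w|[c k]] uw; last first.
    by rewrite !mem_Td_edge_pendant => /eqP -> /eqP.
  rewrite !mem_Td_edge_attached => /eqP wp _ /eqP up _.
  by case/eqP: uw; congr inl; apply: val_inj; rewrite /= up.
congr inl; case: u uw ui uj => [u|u] uw; last by rewrite mem_Td_edge_pendant_path.
case: w uw wi wj => [w|w] uw; last by rewrite mem_Td_edge_pendant_path.
rewrite !mem_Td_edge_path => wi wj ui uj.
have {uw} uw : u != w :> nat by apply: contra_neq uw => /val_inj ->.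
apply: val_inj => /=; case: (ltngtP i j) => // ij; case/eqP: uw.
  have : (i.+1 * m.-1 <= j * m.-1)%N by rewrite leq_mul2r ij orbT.
  by lia.
have : (j.+1 * m.-1 <= i * m.-1)%N by rewrite leq_mul2r ij orbT.
by lia.
Qed.

Lemma Td_edge_sum j :
  \sum_(w in Td_edge j) Td_value w =
  match j with inl i => core_edge i | inr _ => 1 + t 1%N end.
Proof.
case: j => [i|a] /=.
  rewrite big_imset /=; last by move=> ? ? _ _ [].
  pose F k := if (k %% m.-1 == 0)%N then core_value (k %/ m.-1)
              else core_edge (k %/ m.-1) / s.
  under eq_bigl do rewrite inE.
  have F0 q : F (q * m.-1)%N = core_value q by rewrite /F modnMl mulnK.
  rewrite (sum_interval F (ltn_ord i) M_gt0) !F0 -(core_edge_sum (ltn_ord i)).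
  congr (_ + _ + _); rewrite (eq_bigr (fun=> core_edge i / s)) => [|r _].
    by rewrite sumr_const card_ord -[LHS]mulr_natl -[m.-1.-1]subn1 natrB.
  have rM : (r.+1 < m.-1)%N by have := ltn_ord r; lia.
  by rewrite /F modnMDl divnMDl // modn_small // divn_small // addn0.
rewrite /attached_edge big_setU1 /=; last by apply/negP => /imsetP[].
rewrite pendant_vertexE modnMl mulnK //= core_value_mid; congr (1 + _).
rewrite big_imset /=; last by move=> ? ? _ _ [].
rewrite sumr_const card_ord -[LHS]mulr_natl.
have [+ _] := branch_weightS 0 M1 sM; rewrite branch_weight0 subr0 => e.
have t1 := t1_gt0 0.
have /(congr1 (fun z => z * (1 + t 1%N))) : (1 + t 1%N)^-1 + M / s = 1.
  by rewrite -[RHS]e mulrBl mul1r -addrA subrK.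
rewrite mulrDl mulVf ?gt_eqF // mul1r => e1.
apply: (addrI 1); rewrite -[RHS]e1; ring.
Qed.

Lemma Td_lambda1_ge : (s - 1) / M <= lambda1 R m T.
Proof.
pose v0 : W := inl (loose_path_vertex m d p.+1).
have v0E : loose_path_vertex m d p.+1 = (p * m.-1)%N :> nat.
  by rewrite /loose_path_vertex inordK // ltnS leq_mul2r; apply/orP; right; lia.
apply: (@lambda1_ge R _ m T Td_value (s - 1) v0); first by have := M1; have := sM; lra.
  by rewrite /= v0E modnMl mulnK //= core_value_mid oner_neq0.
move=> v; rewrite (indexed_adjacent_sum _ _ Td_edges Td_edge_uniq).
under eq_bigr do rewrite Td_edge_sum.
rewrite big_sumType /=; case: v => [k|[b j]]; last first.
  rewrite big_pred0 ?add0r => [|i]; last by rewrite -(mem_Td_edge_pendant_path i (b, j)).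
  rewrite (big_pred1 b) => [|a]; last by rewrite /= eq_sym -(mem_Td_edge_pendant a b j).
  by rewrite /=; field; rewrite gt_eqF.
under eq_bigl do rewrite -/(Td_edge (inl _)) mem_Td_edge_path.
under [X in _ + X]eq_bigl do rewrite -/(Td_edge (inr _)) mem_Td_edge_attached.
set q := (k %/ m.-1)%N; have kE : k = (q * m.-1 + k %% m.-1)%N :> nat by exact: divn_eq.
have rM : (k %% m.-1 < m.-1)%N by rewrite ltn_mod.
have kd : (k <= d * m.-1)%N by rewrite -ltnS.
have qd : (q <= d)%N by rewrite -(leq_pmul2r M_gt0); lia.
have [r0|r0] := eqVneq (k %% m.-1)%N 0%N.
  have kqE : k = (q * m.-1)%N :> nat by rewrite {1}kE r0 addn0.
  rewrite /= r0 eqxx -/q -(core_vertex_sum qd)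
    -(sum_around d q (fun i => core_edge i - core_value q)); congr (_ + _).
    apply: eq_bigl => i; rewrite kqE !leq_pmul2r //.
    by move: M_gt0; clear; lia.
  rewrite kqE eqn_pmul2r //; case: eqP => [->|_]; last by rewrite big_pred0.
  by rewrite core_value_mid addrAC subrr add0r sumr_const cardT -cardE card_pendants
     ?mulr_natl //; lia.
have kp : (k == p * m.-1 :> nat)%N = false.
  by apply/eqP => kp; case/eqP: r0; rewrite kp modnMl.
rewrite kp [X in _ + X]big_pred0 // addr0 /= (negPf r0) -/q.
have qd' : (q < d)%N by rewrite -(ltn_pmul2r M_gt0); lia.
rewrite (big_pred1 (Ordinal qd')) => [|i /=].
  by field; rewrite gt_eqF.
rewrite -val_eqE /=.
have qM : (q.+1 * m.-1 = m.-1 + q * m.-1)%N by exact: mulSn.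
have iM : (i.+1 * m.-1 = m.-1 + i * m.-1)%N by exact: mulSn.
apply/andP/eqP => [[h1 h2]|iq]; last by rewrite iq; lia.
have iq : (i * m.-1 < q.+1 * m.-1)%N by lia.
have qi : (q * m.-1 < i.+1 * m.-1)%N by lia.
by apply/eqP; move: iq qi; rewrite !ltn_pmul2r // !ltnS eqn_leq => -> ->.
Qed.

End TdEigenvector.

(* The diameter exceeds 1, and conclusion *)
Local Close Scope ring_scope.

(** Two edges meet at some v; vertices a and b of these edges other than v are at distance 2, since
    an edge through both could be bypassed by the walk a, v, b. *)
Lemma diameter_gt1 (V : finType) (H : hypergraph V) (m d : nat) :
  1 < m -> hypertree H -> uniform H m -> 1 < #|edges H| -> has_diameter H d ->
  1 < d.
Proof.
move=> m1 [conn lin acyclic _] unif /card_gt1P[e0 [f0 [e0H f0H ef0]]] [_ diam].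
have [e [f [v [eH fH ef ve vf]]]] : exists e f v,
    [/\ e \in edges H, f \in edges H, e != f, v \in e & v \in f].
  have /set0Pn[c ce] : e0 != set0.
    by apply: contraTneq e0H => ->; exact: edges_neq0.
  have [top [depth [topP _ parent _ rootP]]] := rooted_hypertree c conn lin acyclic.
  have [tc|tc] := eqVneq (top f0) c.
    by exists e0, f0, c; split=> //; rewrite -tc; case: (topP f0 f0H).
  have [e1 [e1H te1 ne1]] := parent _ tc.
  exists e1, f0, (top f0); split=> //; last by case: (topP f0 f0H).
  by apply: contraNneq ne1 => ->.
have other h : h \in edges H -> v \in h -> exists2 a, a \in h & a != v.
  move=> hH vh; have : 1 < #|h| by rewrite unif.
  case/card_gt1P => a [b [ah bh ab]].
  by have [av|] := eqVneq a v; [exists b; rewrite // -av eq_sym|exists a].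
have [a ae av] := other e eH ve; have [b bf bv] := other f fH vf.
have ab : a != b.
  apply: contraNneq ef => ab; apply/eqP/(linear_eq lin eH fH av) => //.
  by rewrite ab.
apply: (diam a b); split.
  exists (fun i : 'I_3 => if i == 0 :> nat then a else if i == 1 :> nat then v else b).
  exists (fun i : 'I_2 => if i == 0 :> nat then e else f); split=> //.
  - move=> [[|[|[|i]]] li] [[|[|[|j]]] lj] //= => h; try exact: val_inj.
    + by rewrite h eqxx in av.
    + by rewrite h eqxx in ab.
    + by rewrite h eqxx in av.
    + by rewrite h eqxx in bv.
    + by rewrite h eqxx in ab.
    + by rewrite h eqxx in bv.
  - move=> [[|[|i]] li] [[|[|j]] lj] //= => h; try exact: val_inj.
      by rewrite h eqxx in ef.
    by rewrite h eqxx in ef.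
  - by move=> [[|[|i]] li].
move=> [|[|n]] // [w [g [_ _ wa wb wg]]].
  by move: ab; rewrite -wa -wb (_ : ord_max = ord0) ?eqxx //; apply: val_inj.
have [hH ah bh] := wg ord0; set h := g ord0 in hH ah bh.
rewrite (_ : widen_ord _ _ = ord0) ?wa in ah; last exact: val_inj.
rewrite (_ : lift _ _ = ord_max) ?wb in bh; last exact: val_inj.
have eh : e != h.
  by apply: contraNneq ef => eh; apply/eqP/(linear_eq lin eH fH bv); rewrite // eh.
have fh : f != h.
  by apply: contraNneq ef => fh; apply/eqP/(linear_eq lin eH fH av); rewrite // fh.
case: (walk_around_edge lin acyclic hH ah bh ab (n := 1 + 1)).
exact: walk_cat (walk1 eH eh ae ve) (walk1 fH fh vf bf).
Qed.

Unset Implicit Arguments.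

Theorem theorem2p1p2 (R : realType) (m k d p : nat) (V : finType)
    (T : hypergraph V) (hm : 2 <= m) (hT : hypertree T) (hTm : uniform T m)
    (hk : #|edges T| = k) (hdiam : has_diameter T d) (hd : d = 2 * p + 1)
    (hkd : 6 <= (k - d - 1) * (m - 1)) :
  let T' := Td m d (fun i => if i == p + 1 then k - d else 0) in
  (lambda1 R m T <= lambda1 R m T')%R /\
  (lambda1 R m T = lambda1 R m T' -> hypergraph_iso T T').
Proof.
(* The subtraction is truncated: if k - d were at most 1 the product would be 0. *)
have kd : d + 2 <= k by move: hkd; case E : (k - d) => [|[|n]] //= _; lia.
have d1 : 1 < d by apply: (diameter_gt1 hm hT hTm _ hdiam); lia.
have p0 : 0 < p by lia.
have [conn lin acyclic two] := hT.
have [[a [b [/joined_by_path_spine[x [g xg]] _]]] _] := hdiam.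
move: hkd kd xg; rewrite {}hd => hkd kd xg {hdiam d1 d}.
set d := 2 * p + 1 in hkd kd xg *; set n := k - d in hkd *.
have n1 : 1 < n by rewrite /n; lia.
have cE : #|edges T| = d + n by rewrite hk /n; lia.
have M1 : (1 <= m.-1%:R :> R)%R by rewrite ler1n; lia.
have nM : (6 <= (n%:R - 1) * m.-1%:R :> R)%R.
  have -> : (n%:R - 1 = (n - 1)%:R :> R)%R by rewrite [RHS]natrB ?(ltnW n1).
  by rewrite -natrM (ler_nat _ 6) -subn1.
have [s sM bal] := exists_balanced_weight M1 p0 nM.
have [top [depth rootedT]] := rooted_hypertree (x p) conn lin acyclic.
have [le tight] := hypertree_bound hm (ltnW n1) p0 hTm two xg rootedT cE sM bal.
have ge := Td_lambda1_ge hm p0 sM bal; split; first exact: le_trans ge.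
have pd : p < d by rewrite /d; lia.
move=> eq; have {}eq : lambda1 R m T = ((s - 1) / m.-1%:R)%R.
  by apply/le_anti; rewrite le eq ge.
have [off|off] := tight conn eq.
  apply: (spine_iso _ _ _ _ xg rootedT cE) => // f fT fg; apply: off => //.
  by apply/eqP/(off_spineP p0 xg).
(* The edges off the spine meet at [x p.+1], which is vertex p of the reversed spine; the tree is
   rooted again there. *)
have xg' := spine_rev xg.
have xp : x p.+1 = x (d - p) by congr x; rewrite /d; lia.
have [top' [depth' rootedT']] := rooted_hypertree (x (d - p)) conn lin acyclic.
apply: (spine_iso _ _ _ _ xg' rootedT' cE) => // f fT fg; rewrite -xp.
apply: off => //; apply/eqP/(off_spineP p0 xg) => // j jd.
have -> : j = d - (d - j.+1).+1 by lia.
by apply: fg; lia.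
Qed.
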